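(* Let $\varepsilon>0$ be small, let $(\varepsilon_j)_{j\in\mathbb{Z}}$ be real numbers with $|\varepsilon_j|<\varepsilon$ for all $j$, let $C$ be a nonzero real constant, and let $$f(z)=C\,(z-\varepsilon_0)\prod_{j\neq 0}\Bigl(1-\frac{z}{j+\varepsilon_j}\Bigr)\exp\Bigl(\frac{z}{j+\varepsilon_j}\Bigr).$$ Let $(z_n^j)_n$ denote the zeros, in increasing order, of the $j$th derivative $f^{(j)}$. Then $z^j_{n+1}-z^j_n=1+O(\varepsilon j^{-1})$. *)

(* Defs.v *)
From Stdlib Require Export Reals ZArith List.
From Coquelicot Require Export Coquelicot.

Open Scope R_scope.

(* exp (x + i y) = exp x (cos y + i sin y); Coquelicot has no complex exponential. *)
Definition Cexp (z : C) : C := (exp (Re z) * cos (Im z), exp (Re z) * sin (Im z)).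

(* Componentwise like C_lim: the value is meaningful only if the sequence
   converges in C, as CLim_seq_correct makes explicit. *)
Definition CLim_seq (u : nat -> C) : C :=
  (real (Lim_seq (fun n => Re (u n))), real (Lim_seq (fun n => Im (u n)))).

Lemma CLim_seq_correct (u : nat -> C) (l : C) :
  filterlim u eventually (locally l) -> CLim_seq u = l.
Proof.
  intros H.
  assert (HR : is_lim_seq (fun n => Re (u n)) (Re l)).
  { apply (filterlim_comp _ _ _ u Re eventually (locally l) (locally (Re l)) H).
    intros P [d Hd]. exists d. intros y [Hy _]. exact (Hd _ Hy). }
  assert (HI : is_lim_seq (fun n => Im (u n)) (Im l)).
  { apply (filterlim_comp _ _ _ u Im eventually (locally l) (locally (Im l)) H).
    intros P [d Hd]. exists d. intros y [_ Hy]. exact (Hd _ Hy). }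
  unfold CLim_seq.
  rewrite (is_lim_seq_unique _ _ HR), (is_lim_seq_unique _ _ HI).
  destruct l; reflexivity.
Qed.

(* The product of the a k over 0 < |k| <= N. *)
Fixpoint Cprod_sym (a : Z -> C) (N : nat) : C :=
  match N with
  | O => RtoC 1
  | S M => (Cprod_sym a M * a (Z.of_nat N) * a (- Z.of_nat N)%Z)%C
  end.

(* For eps j bounded by a constant < 1 the infinite product converges absolutely,
   so taking symmetric partial products does not affect its value. *)
Definition canonical_product (c : R) (eps : Z -> R) (z : C) : C :=
  (RtoC c * (z - RtoC (eps 0%Z)) *
   CLim_seq (Cprod_sym (fun j : Z =>
     let w := z / RtoC (IZR j + eps j) in (1 - w) * Cexp w)))%C.

Definition C_derive_n (f : C -> C) (n : nat) : C -> C := Nat.iter n C_derive f.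

Definition zero_order (g : C -> C) (w : C) (m : nat) : Prop :=
  (forall k : nat, (k < m)%nat -> C_derive_n g k w = RtoC 0) /\
  C_derive_n g m w <> RtoC 0.

(* z lists, in increasing order and with multiplicity, all the zeros of g in C.
   Taking m = 0, a point where g does not vanish is not listed. *)
Definition lists_zeros (g : C -> C) (z : Z -> R) : Prop :=
  (forall n : Z, z n <= z (n + 1)%Z) /\
  (forall (w : C) (m : nat), zero_order g w m ->
     exists l : list Z, NoDup l /\ length l = m /\
       forall n : Z, In n l <-> RtoC (z n) = w).

(* Main.v *)
(** On the real line every derivative of f is, up to a nonzero constant,
    exp (b x) times a symmetric product over its zeros t_k, with one and the same
    real b = O(eps).  Its critical points s_n, one in each gap of (t_k), solve
    b + p.v. sum_m 1/(x - t_m) = 0; approximating by finite products, whose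
    derivatives factor over their interlacing zeros, shows that f' has the same
    form with the zeros s_n.

    Subtracting the equations of s_(n+r) and s_n exhibits s_(n+r) - s_n - r as a
    weighted average of the numbers t_(m+r) - t_m - r with the positive weights
    1/((s_n - t_m)(s_(n+r) - t_(m+r))).  Hence the bound 2 eps on these numbers is
    inherited by all derivatives.  For r = 1 the weights dominate c/l^2 on the l
    indices below n, over which the deviations telescope to at most 2 eps; so the
    largest deviation M of a gap from 1 drops to at most
    (1 - c/l) M + 2 c eps / l^2, and taking l proportional to j yields
    M = O(eps / j) for the j-th derivative. *)
Require Import Defs.
From Stdlib Require Import Lra Lia Psatz Ranalysis5 ClassicalEpsilon.

(** * Sums and products dominated by inverse squares *)

(** The proof stays on the real line: [C_derive] at a real point is computed from the values at real
    points alone, and the multiplicities in [lists_zeros] reduce to simplicity of the zeros, read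
    off from the next derivative. The obstacle is that b must survive differentiation. If P is the
    truncated product with 2n + 2 zeros, then b P + P' has 2n + 1 zeros in the gaps and one further
    linear factor. By Vieta and interlacing, the constant term of that factor grows at least like n
    as long as |b| <= 1/3, so the factor, normalized at a fixed point, tends to 1 and contributes
    neither a zero nor an exponential. Neither the principal value nor the product converges
    absolutely without pairing. In pairs the errors are O(1/k^2), so [inv_sq] is the common majorant
    and limits are exchanged by domination. *)

Fixpoint bsum (f : nat -> R) (n : nat) : R :=
  match n with O => 0 | S m => bsum f m + f m end.

Fixpoint bprod (f : nat -> R) (n : nat) : R :=
  match n with O => 1 | S m => bprod f m * f m end.

Definition sums_to (f : nat -> R) (l : R) : Prop := is_lim_seq (bsum f) l.

Definition inv_sq (k : nat) : R := / (INR k + 1) ^ 2.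

Lemma sq_pos (k : nat) : 0 < inv_sq k.
Proof. unfold inv_sq. apply Rinv_0_lt_compat. pose proof (pos_INR k). nra. Qed.

Lemma bsum_ext (f g : nat -> R) (n : nat) :
  (forall k, (k < n)%nat -> f k = g k) -> bsum f n = bsum g n.
Proof.
  induction n as [|n IH]; simpl; intros H; [reflexivity|].
  rewrite IH, H by (intros; auto with arith); reflexivity.
Qed.

Lemma bsum_le (f g : nat -> R) (n : nat) :
  (forall k, (k < n)%nat -> f k <= g k) -> bsum f n <= bsum g n.
Proof.
  induction n as [|n IH]; simpl; intros H; [lra|].
  pose proof (H n ltac:(lia)). pose proof (IH ltac:(intros; apply H; lia)). lra.
Qed.

Lemma bsum_plus (f g : nat -> R) (n : nat) :
  bsum (fun k => f k + g k) n = bsum f n + bsum g n.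
Proof. induction n as [|n IH]; simpl; [ring|rewrite IH; ring]. Qed.

Lemma bsum_scal (a : R) (f : nat -> R) (n : nat) :
  bsum (fun k => a * f k) n = a * bsum f n.
Proof. induction n as [|n IH]; simpl; [ring|rewrite IH; ring]. Qed.

Lemma bsum_Rabs (f : nat -> R) (n : nat) :
  Rabs (bsum f n) <= bsum (fun k => Rabs (f k)) n.
Proof.
  induction n as [|n IH]; simpl; [rewrite Rabs_R0; lra|].
  eapply Rle_trans; [apply Rabs_triang|lra].
Qed.

Lemma bsum_nonneg (f : nat -> R) (n : nat) :
  (forall k, (k < n)%nat -> 0 <= f k) -> 0 <= bsum f n.
Proof.
  intros H. induction n as [|n IH]; simpl; [lra|].
  pose proof (H n ltac:(lia)). pose proof (IH ltac:(intros; apply H; lia)). lra.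
Qed.

Lemma bsum_mono (f : nat -> R) (m n : nat) :
  (forall k, 0 <= f k) -> (m <= n)%nat -> bsum f m <= bsum f n.
Proof.
  intros H. induction 1 as [|n _ IH]; simpl; [lra|]. pose proof (H n). lra.
Qed.

(* 1/(k+1)^2 <= 1/k - 1/(k+1) *)
Lemma bsum_sq_tail (m n : nat) :
  (1 <= m)%nat -> (m <= n)%nat -> bsum inv_sq n - bsum inv_sq m <= / INR m - / INR n.
Proof.
  intros Hm. induction 1 as [|n Hn IH]; [lra|].
  cbn [bsum]. rewrite S_INR.
  assert (H1 : 1 <= INR n) by (replace 1 with (INR 1) by reflexivity; apply le_INR; lia).
  assert (inv_sq n <= / INR n - / (INR n + 1)); [|lra].
  unfold inv_sq. replace (/ INR n - / (INR n + 1)) with (/ (INR n * (INR n + 1))) by (field; lra).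
  apply Rinv_le_contravar; nra.
Qed.

Lemma bsum_sq_le (n : nat) : bsum inv_sq n <= 2.
Proof.
  destruct n as [|n]; [simpl; lra|].
  pose proof (bsum_sq_tail 1 (S n) ltac:(lia) ltac:(lia)) as H.
  assert (bsum inv_sq 1 = 1) by (unfold inv_sq; simpl; field).
  assert (0 < / INR (S n)) by (apply Rinv_0_lt_compat, lt_0_INR; lia).
  replace (/ INR 1) with 1 in H by (simpl; field). lra.
Qed.

Lemma bsum_decay (f : nat -> R) (C : R) (n : nat) :
  (forall k, (k < n)%nat -> Rabs (f k) <= C * inv_sq k) -> 0 <= C -> bsum (fun k => Rabs (f k)) n <= 2 * C.
Proof.
  intros H HC.
  eapply Rle_trans; [apply bsum_le; exact H|]. rewrite bsum_scal.
  pose proof (bsum_sq_le n). nra.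
Qed.

Lemma bsum_sum_n (f : nat -> R) (n : nat) : sum_n f n = bsum f (S n).
Proof.
  induction n as [|n IH]; [rewrite sum_O; simpl; ring|].
  rewrite sum_Sn, IH. reflexivity.
Qed.

Lemma sums_to_is_series (f : nat -> R) (l : R) : is_series f l -> sums_to f l.
Proof.
  intros H. apply is_lim_seq_incr_1.
  apply is_lim_seq_ext with (sum_n f); [apply bsum_sum_n|exact H].
Qed.

Lemma sums_to_ext (f g : nat -> R) (l : R) :
  (forall k, f k = g k) -> sums_to f l -> sums_to g l.
Proof.
  intros H. apply is_lim_seq_ext. intros n. apply bsum_ext. auto.
Qed.

Lemma sums_to_plus (f g : nat -> R) (l m : R) :
  sums_to f l -> sums_to g m -> sums_to (fun k => f k + g k) (l + m).
Proof.
  intros Hf Hg.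
  apply is_lim_seq_ext with (fun n => bsum f n + bsum g n).
  - intros n. symmetry. apply bsum_plus.
  - apply is_lim_seq_plus'; assumption.
Qed.

Lemma sums_to_scal (a : R) (f : nat -> R) (l : R) :
  sums_to f l -> sums_to (fun k => a * f k) (a * l).
Proof.
  intros Hf. apply is_lim_seq_ext with (fun n => a * bsum f n).
  - intros n. symmetry. apply bsum_scal.
  - apply (is_lim_seq_scal_l (bsum f) a l). exact Hf.
Qed.

Lemma sums_to_minus (f g : nat -> R) (l m : R) :
  sums_to f l -> sums_to g m -> sums_to (fun k => f k - g k) (l - m).
Proof.
  intros Hf Hg.
  apply sums_to_ext with (fun k => f k + (-1) * g k); [intros; ring|].
  replace (l - m) with (l + (-1) * m) by ring.
  apply sums_to_plus; [|apply sums_to_scal]; assumption.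
Qed.

Lemma sums_to_ge_partial (f : nat -> R) (l : R) (n : nat) :
  (forall k, 0 <= f k) -> sums_to f l -> bsum f n <= l.
Proof.
  intros Hf Hl.
  apply (is_lim_seq_le_loc (fun _ => bsum f n) (bsum f) (bsum f n) l).
  - exists n. intros m Hm. apply bsum_mono; auto.
  - apply is_lim_seq_const.
  - exact Hl.
Qed.

Lemma sums_to_le (f : nat -> R) (l B : R) :
  (forall n, bsum f n <= B) -> sums_to f l -> l <= B.
Proof.
  intros H Hl.
  apply (is_lim_seq_le (bsum f) (fun _ => B) l B H Hl (is_lim_seq_const B)).
Qed.

Lemma sums_to_Rabs_le (f : nat -> R) (l B : R) :
  (forall n, bsum (fun k => Rabs (f k)) n <= B) -> sums_to f l -> Rabs l <= B.
Proof.
  intros H Hl.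
  apply (is_lim_seq_le (fun n => Rabs (bsum f n)) (fun _ => B) (Rabs l) B).
  - intros n. eapply Rle_trans; [apply bsum_Rabs|apply H].
  - apply (is_lim_seq_abs (bsum f) l Hl).
  - apply is_lim_seq_const.
Qed.

Lemma sums_to_decay (f : nat -> R) (C : R) :
  (forall k, Rabs (f k) <= C * inv_sq k) -> exists l, sums_to f l.
Proof.
  intros H.
  assert (Hsq : ex_series inv_sq).
  { assert (Hb : ex_finite_lim_seq (bsum inv_sq)).
    { apply ex_finite_lim_seq_incr with 2.
      - intros n. simpl. pose proof (sq_pos n). lra.
      - apply bsum_sq_le. }
    destruct Hb as [l Hl]. exists l.
    change (is_lim_seq (sum_n inv_sq) l).
    apply is_lim_seq_ext with (fun n => bsum inv_sq (S n)).
    - intros n. symmetry. apply bsum_sum_n.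
    - apply (is_lim_seq_incr_1 (bsum inv_sq)). exact Hl. }
  assert (Hf : ex_series f).
  { apply (ex_series_le f (fun k => C * inv_sq k)); [exact H|].
    exact (ex_series_scal C inv_sq Hsq). }
  destruct Hf as [l Hl]. exists l. apply sums_to_is_series, Hl.
Qed.

(** Dominated convergence for a triangular array: a fixed head tends to 0 termwise and the tail is
    at most C / (m + 1). Row n is controlled only for k < n and n >= n0, because the zeros of the
    n-th truncation are under control only for indices up to n and for large n. *)
Lemma tannery (d : nat -> nat -> R) (C : R) (n0 : nat) :
  0 <= C ->
  (forall n k, (n0 <= n)%nat -> (k < n)%nat -> Rabs (d n k) <= C * inv_sq k) ->
  (forall k, is_lim_seq (fun n => d n k) 0) ->
  is_lim_seq (fun n => bsum (fun k => Rabs (d n k)) n) 0.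
Proof.
  intros HC Hd Hlim.
  assert (Hfin : forall m, is_lim_seq (fun n => bsum (fun k => Rabs (d n k)) m) 0).
  { induction m as [|m IH]; simpl; [apply is_lim_seq_const|].
    replace (Finite 0) with (Finite (0 + 0)) by (f_equal; ring).
    apply is_lim_seq_plus'; [exact IH|].
    rewrite <- Rabs_R0. apply (is_lim_seq_abs _ 0), Hlim. }
  apply is_lim_seq_spec. intros eps. simpl.
  (* This m makes the tail bound C / (m + 1) at most eps / 2. *)
  destruct (nfloor_ex (2 * C / eps)) as [m [_ Hm]].
  { apply Rmult_le_pos; [lra|]. left. apply Rinv_0_lt_compat, cond_pos. }
  pose proof (cond_pos eps) as He.
  assert (He2 : 0 < eps / 2) by lra.
  destruct (proj2 (is_lim_seq_spec _ _) (Hfin (S m)) (mkposreal _ He2)) as [N HN].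
  simpl in HN. exists (max n0 (max N (S m))). intros n Hn.
  specialize (HN n ltac:(lia)).
  rewrite !Rminus_0_r in *. apply Rabs_def2 in HN.
  assert (Hnn : forall j, 0 <= bsum (fun k => Rabs (d n k)) j)
    by (intros; apply bsum_nonneg; intros; apply Rabs_pos).
  rewrite Rabs_pos_eq by apply Hnn.
  assert (Htail : forall j, (S m <= j)%nat -> (j <= n)%nat ->
    bsum (fun k => Rabs (d n k)) j <=
    bsum (fun k => Rabs (d n k)) (S m) + C * (bsum inv_sq j - bsum inv_sq (S m))).
  { induction 1 as [|j Hj IH]; intros Hjn; [lra|].
    specialize (IH ltac:(lia)). pose proof (Hd n j ltac:(lia) ltac:(lia)).
    cbn [bsum] in *. lra. }
  specialize (Htail n ltac:(lia) ltac:(lia)).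
  pose proof (bsum_sq_tail (S m) n ltac:(lia) ltac:(lia)) as Hs.
  assert (0 < / INR n) by (apply Rinv_0_lt_compat, lt_0_INR; lia).
  assert (HS : 2 * C / eps < INR (S m)) by (rewrite S_INR; exact Hm).
  assert (HSp : 0 < INR (S m)) by (apply lt_0_INR; lia).
  assert (C * / INR (S m) <= eps / 2).
  { apply Rmult_le_reg_r with (INR (S m)); [exact HSp|].
    rewrite Rmult_assoc, Rinv_l, Rmult_1_r by lra.
    apply (Rmult_lt_compat_r (eps/2)) in HS; [|lra].
    replace (2 * C / eps * (eps / 2)) with C in HS by (field; lra). lra. }
  apply (Rmult_le_compat_l C) in Hs; [|exact HC].
  assert (0 <= C * / INR n) by (apply Rmult_le_pos; lra).
  cbn [bsum] in *. lra.
Qed.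

(** * Infinite products with factors 1 + O(1/k^2) *)

Lemma bprod_exp_bound (a : nat -> R) (C : R) (n : nat) :
  0 <= C -> (forall k, (k < n)%nat -> Rabs (a k - 1) <= C * inv_sq k) ->
  Rabs (bprod a n) <= exp (C * bsum inv_sq n).
Proof.
  intros HC. induction n as [|n IH]; intros H; simpl.
  - rewrite Rabs_R1, Rmult_0_r, exp_0. lra.
  - rewrite Rabs_mult, Rmult_plus_distr_l, exp_plus.
    apply Rmult_le_compat; try apply Rabs_pos.
    + apply IH. intros; apply H; lia.
    + pose proof (H n ltac:(lia)) as Hn.
      pose proof (exp_ineq1_le (C * inv_sq n)).
      replace (a n) with (1 + (a n - 1)) by ring.
      eapply Rle_trans; [apply Rabs_triang|]. rewrite Rabs_R1. lra.
Qed.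

Lemma exp_bsum_sq (C : R) (n : nat) : 0 <= C -> exp (C * bsum inv_sq n) <= exp (2 * C).
Proof.
  intros HC. pose proof (bsum_sq_le n).
  destruct (Rle_lt_or_eq_dec (C * bsum inv_sq n) (2 * C)) as [H1|H1]; [nra| |].
  - left. apply exp_increasing, H1.
  - rewrite H1. lra.
Qed.

(** The factors are exchanged one at a time; what stands before and after the exchanged factor is
    bounded by the exponential of [bprod_exp_bound]. *)
Lemma bprod_diff (a b : nat -> R) (C : R) (n : nat) :
  0 <= C ->
  (forall k, (k < n)%nat -> Rabs (a k - 1) <= C * inv_sq k) ->
  (forall k, (k < n)%nat -> Rabs (b k - 1) <= C * inv_sq k) ->
  Rabs (bprod a n - bprod b n) <=
    exp (C * bsum inv_sq n) * bsum (fun k => Rabs (a k - b k)) n.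
Proof.
  intros HC. induction n as [|n IH]; intros Ha Hb; simpl.
  - rewrite Rminus_diag, Rabs_R0. lra.
  - specialize (IH ltac:(intros; apply Ha; lia) ltac:(intros; apply Hb; lia)).
    pose proof (bprod_exp_bound b C n HC ltac:(intros; apply Hb; lia)) as Hbn.
    pose proof (Ha n ltac:(lia)) as Han.
    pose proof (exp_ineq1_le (C * inv_sq n)) as He.
    pose proof (sq_pos n) as Hs.
    assert (Han' : Rabs (a n) <= exp (C * inv_sq n)).
    { replace (a n) with (1 + (a n - 1)) by ring.
      eapply Rle_trans; [apply Rabs_triang|]. rewrite Rabs_R1. lra. }
    replace (bprod a n * a n - bprod b n * b n)
      with ((bprod a n - bprod b n) * a n + bprod b n * (a n - b n)) by ring.
    eapply Rle_trans; [apply Rabs_triang|]. rewrite !Rabs_mult.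
    rewrite (Rmult_plus_distr_l C), exp_plus.
    set (E := exp (C * bsum inv_sq n)) in *. set (e := exp (C * inv_sq n)) in *.
    assert (0 < E) by apply exp_pos.
    assert (1 <= e) by nra.
    set (S := bsum (fun k => Rabs (a k - b k)) n) in *.
    assert (H1 : Rabs (bprod a n - bprod b n) * Rabs (a n) <= E * S * e).
    { apply Rmult_le_compat; auto using Rabs_pos. }
    assert (H2 : Rabs (bprod b n) * Rabs (a n - b n) <= E * e * Rabs (a n - b n)).
    { apply Rmult_le_compat_r; [apply Rabs_pos|]. nra. }
    lra.
Qed.

Lemma bprod_tannery (a : nat -> nat -> R) (b : nat -> R) (C : R) (n0 : nat) :
  0 <= C ->
  (forall n k, (n0 <= n)%nat -> (k < n)%nat -> Rabs (a n k - 1) <= C * inv_sq k) ->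
  (forall k, Rabs (b k - 1) <= C * inv_sq k) ->
  (forall k, is_lim_seq (fun n => a n k) (b k)) ->
  is_lim_seq (fun n => bprod (a n) n - bprod b n) 0.
Proof.
  intros HC Ha Hb Hlim.
  apply is_lim_seq_abs_0.
  apply (is_lim_seq_le_le_loc (fun _ => 0) _
    (fun n => exp (2 * C) * bsum (fun k => Rabs (a n k - b k)) n)).
  - exists n0. intros n Hn. split; [apply Rabs_pos|].
    eapply Rle_trans; [apply (bprod_diff _ _ C); auto|].
    apply Rmult_le_compat_r; [|apply exp_bsum_sq, HC].
    apply bsum_nonneg; intros; apply Rabs_pos.
  - apply is_lim_seq_const.
  - replace (Finite 0) with (Rbar_mult (exp (2 * C)) 0) by (simpl; f_equal; ring).
    apply is_lim_seq_scal_l.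
    apply (tannery (fun n k => a n k - b k) (2 * C) n0); [lra| |].
    + intros n k Hn Hk. replace (a n k - b k) with ((a n k - 1) - (b k - 1)) by ring.
      eapply Rle_trans; [apply Rabs_triang|]. rewrite Rabs_Ropp.
      pose proof (Ha n k Hn Hk). pose proof (Hb k). lra.
    + intros k. replace (Finite 0) with (Finite (b k - b k)) by (f_equal; ring).
      apply is_lim_seq_minus'; [apply Hlim|apply is_lim_seq_const].
Qed.

(** Successive partial products differ by [bprod a k * (a k - 1)], which is summable because the
    partial products are bounded. *)
Lemma bprod_ex_lim (a : nat -> R) (C : R) :
  0 <= C -> (forall k, Rabs (a k - 1) <= C * inv_sq k) ->
  exists l : R, is_lim_seq (bprod a) l.
Proof.
  intros HC Ha.
  destruct (sums_to_decay (fun k => bprod a k * (a k - 1)) (exp (2 * C) * C)) as [l Hl].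
  - intros k. rewrite Rabs_mult, Rmult_assoc.
    apply Rmult_le_compat; try apply Rabs_pos; [|apply Ha].
    eapply Rle_trans; [apply (bprod_exp_bound a C k HC); auto|apply exp_bsum_sq, HC].
  - exists (1 + l).
    apply is_lim_seq_ext with (fun n => 1 + bsum (fun k => bprod a k * (a k - 1)) n).
    + induction n as [|n IH]; simpl in *; [ring|].
      replace (1 + (bsum (fun k => bprod a k * (a k - 1)) n + bprod a n * (a n - 1)))
        with ((1 + bsum (fun k => bprod a k * (a k - 1)) n) + bprod a n * (a n - 1)) by ring.
      rewrite IH. ring.
    + apply is_lim_seq_plus'; [apply is_lim_seq_const|exact Hl].
Qed.

(* Past an index where the tail of the deviations is at most 1/2, the partial
   products lose at most half of their modulus. *)
Lemma bprod_lim_neq_0 (a : nat -> R) (C l : R) :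
  0 <= C -> (forall k, Rabs (a k - 1) <= C * inv_sq k) -> (forall k, a k <> 0) ->
  is_lim_seq (bprod a) l -> l <> 0.
Proof.
  intros HC Ha Hnz Hl.
  destruct (nfloor_ex (2 * C)) as [m [_ Hm]]; [lra|].
  assert (HSp : 0 < INR (S m)) by (apply lt_0_INR; lia).
  assert (Hhalf : C * / INR (S m) <= 1 / 2).
  { apply Rmult_le_reg_r with (INR (S m)); [exact HSp|].
    rewrite Rmult_assoc, Rinv_l, Rmult_1_r by lra. rewrite S_INR in *. lra. }
  assert (Hpm : forall n, 0 < Rabs (bprod a n)).
  { induction n as [|n IH]; simpl; [rewrite Rabs_R1; lra|].
    rewrite Rabs_mult. apply Rmult_lt_0_compat; [exact IH|apply Rabs_pos_lt, Hnz]. }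
  assert (Hlow : forall n, (S m <= n)%nat ->
    Rabs (bprod a (S m)) * (1 - C * (bsum inv_sq n - bsum inv_sq (S m))) <= Rabs (bprod a n)).
  { induction 1 as [|n Hn IH]; [rewrite Rminus_diag; lra|].
    change (bprod a (S n)) with (bprod a n * a n). rewrite (Rabs_mult (bprod a n)).
    pose proof (Ha n) as Hd. pose proof (sq_pos n).
    pose proof (bsum_sq_tail (S m) n ltac:(lia) Hn) as Ht.
    assert (0 < / INR n) by (apply Rinv_0_lt_compat, lt_0_INR; lia).
    pose proof (bsum_mono inv_sq (S m) n ltac:(intros; left; apply sq_pos) Hn).
    set (T := bsum inv_sq n - bsum inv_sq (S m)) in *.
    assert (Hx : bsum inv_sq (S n) - bsum inv_sq (S m) = T + inv_sq n) by (unfold T; cbn [bsum]; ring).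
    rewrite Hx.
    assert (HT : 0 <= C * T <= 1 / 2).
    { assert (0 <= T) by (unfold T; lra). split; [apply Rmult_le_pos; assumption|].
      apply Rle_trans with (C * / INR (S m)); [apply Rmult_le_compat_l; lra|exact Hhalf]. }
    assert (Han : 1 - C * inv_sq n <= Rabs (a n)).
    { pose proof (Rabs_triang_inv 1 (1 - a n)) as Hi.
      replace (1 - (1 - a n)) with (a n) in Hi by ring.
      rewrite Rabs_R1, (Rabs_minus_sym 1) in Hi. lra. }
    pose proof (Hpm (S m)) as Hp.
    set (p := Rabs (bprod a (S m))) in *. set (q := Rabs (bprod a n)) in *.
    assert (0 < q) by apply Hpm.
    apply Rle_trans with (p * (1 - C * T) * Rabs (a n)).
    - rewrite Rmult_assoc. apply Rmult_le_compat_l; [lra|].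
      assert (0 <= C * inv_sq n) by nra. nra.
    - apply Rmult_le_compat_r; [apply Rabs_pos|exact IH]. }
  assert (Hge : Rabs (bprod a (S m)) / 2 <= Rabs l).
  { apply (is_lim_seq_le_loc (fun _ => Rabs (bprod a (S m)) / 2)
             (fun n => Rabs (bprod a n)) (Rabs (bprod a (S m)) / 2) (Rabs l)).
    - exists (S m). intros n Hn.
      eapply Rle_trans; [|apply Hlow, Hn].
      pose proof (bsum_sq_tail (S m) n ltac:(lia) Hn) as Ht.
      assert (0 < / INR n) by (apply Rinv_0_lt_compat, lt_0_INR; lia).
      pose proof (Hpm (S m)) as Hp.
      assert (C * (bsum inv_sq n - bsum inv_sq (S m)) <= 1 / 2).
      { apply Rle_trans with (C * / INR (S m)); [apply Rmult_le_compat_l; lra|exact Hhalf]. }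
      nra.
    - apply is_lim_seq_const.
    - apply (is_lim_seq_abs _ l Hl). }
  pose proof (Hpm (S m)). intros ->. rewrite Rabs_R0 in Hge. lra.
Qed.

(** * Evolution of the gaps *)

(* The terms of p.v. sum_m 1/(x - t m), paired symmetrically about n + 1/2. *)
Definition pterm (t : Z -> R) (n : Z) (x : R) (k : nat) : R :=
  / (x - t (n - Z.of_nat k)%Z) + / (x - t (n + 1 + Z.of_nat k)%Z).

(** The equation says that b + p.v. sum_m 1/(x - t m), the logarithmic derivative, vanishes at x = s
    n. Each n is paired about its own gap, so that [critical_shift] can compare terms with equal k;
    [pterm_recenter] moves the centre. *)
Definition critical (t : Z -> R) (b : R) (s : Z -> R) : Prop :=
  forall n : Z, t n < s n < t (n + 1)%Z /\ sums_to (pterm t n (s n)) (- b).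

(** All r are bounded at once: a bound on single gaps would let the errors accumulate, and the
    telescoping in [gap_critical] would yield nothing. *)
Definition osc (t : Z -> R) (e : R) : Prop :=
  forall m r : Z, Rabs (t (m + r)%Z - t m - IZR r) <= e.

Definition increasing (t : Z -> R) : Prop := forall n : Z, t n < t (n + 1)%Z.

Lemma increasing_le (t : Z -> R) (m n : Z) :
  increasing t -> (m <= n)%Z -> t m <= t n.
Proof.
  intros Ht H.
  assert (Hk : forall k : nat, t m <= t (m + Z.of_nat k)%Z).
  { induction k as [|k IH]; [rewrite Z.add_0_r; lra|].
    rewrite Nat2Z.inj_succ. unfold Z.succ. rewrite Z.add_assoc.
    pose proof (Ht (m + Z.of_nat k)%Z). lra. }
  specialize (Hk (Z.to_nat (n - m))).
  rewrite Z2Nat.id in Hk by lia.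
  replace (m + (n - m))%Z with n in Hk by ring. exact Hk.
Qed.

Lemma increasing_lt (t : Z -> R) (m n : Z) :
  increasing t -> (m < n)%Z -> t m < t n.
Proof.
  intros Ht H. apply Rlt_le_trans with (t (m + 1)%Z); [apply Ht|].
  apply increasing_le; [exact Ht|lia].
Qed.

Lemma osc_growth (t : Z -> R) (e : R) (m : Z) (k : nat) :
  osc t e -> e <= 1 / 10 ->
  9 / 10 * INR k <= t (m + Z.of_nat k)%Z - t m <= 11 / 10 * INR k.
Proof.
  intros Ho He. destruct k as [|k].
  - simpl. rewrite Z.add_0_r. lra.
  - pose proof (Ho m (Z.of_nat (S k))) as H. rewrite <- INR_IZR_INZ in H.
    apply Rabs_le_between in H.
    assert (1 <= INR (S k)) by (replace 1 with (INR 1) by reflexivity; apply le_INR; lia).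
    lra.
Qed.

Lemma osc_increasing (t : Z -> R) (e : R) : osc t e -> e <= 1 / 10 -> increasing t.
Proof.
  intros Ho He n. pose proof (osc_growth t e n 1 Ho He) as H. simpl in H. lra.
Qed.

(** 1/(s' - t') - 1/(s - t) = ((s - t) - (s' - t')) / ((s - t)(s' - t')), whose numerator is u - w
    because r cancels. The weights are positive since s n and s (n + r) lie in the gaps n and n + r,
    so both factors change sign at the same m. *)
Lemma critical_shift (t s : Z -> R) (b : R) (n r : Z) :
  increasing t -> critical t b s ->
  let w := s (n + r)%Z - s n - IZR r in
  let u := fun m => t (m + r)%Z - t m - IZR r in
  let om := fun m => / ((s n - t m) * (s (n + r)%Z - t (m + r)%Z)) in
  (forall m, 0 < om m) /\
  sums_to (fun k : nat => om (n - Z.of_nat k)%Z * (u (n - Z.of_nat k)%Z - w) +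
    om (n + 1 + Z.of_nat k)%Z * (u (n + 1 + Z.of_nat k)%Z - w)) 0.
Proof.
  intros Ht Hc w u om.
  assert (Hsgn : forall m, (0 < s n - t m /\ 0 < s (n + r)%Z - t (m + r)%Z) \/
                           (s n - t m < 0 /\ s (n + r)%Z - t (m + r)%Z < 0)).
  { intros m. destruct (Hc n) as [H1 _]. destruct (Hc (n + r)%Z) as [H2 _].
    destruct (Z_le_gt_dec m n) as [Hm|Hm]; [left|right].
    - pose proof (increasing_le t m n Ht Hm).
      pose proof (increasing_le t (m + r) (n + r) Ht ltac:(lia)). lra.
    - pose proof (increasing_le t (n + 1) m Ht ltac:(lia)).
      pose proof (increasing_le t (n + r + 1) (m + r) Ht ltac:(lia)). lra. }
  split.
  - intros m. apply Rinv_0_lt_compat. destruct (Hsgn m) as [[]|[]]; nra.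
  - replace 0 with (- b - - b) by ring.
    eapply sums_to_ext; [|apply sums_to_minus; [apply (proj2 (Hc (n + r)%Z))|apply (proj2 (Hc n))]].
    assert (Hterm : forall m, / (s (n + r)%Z - t (m + r)%Z) - / (s n - t m) = om m * (u m - w)).
    { intros m. unfold om, u, w. destruct (Hsgn m) as [[]|[]]; field; lra. }
    intros k. unfold pterm. rewrite <- !Hterm.
    replace (n + r - Z.of_nat k)%Z with (n - Z.of_nat k + r)%Z by ring.
    replace (n + r + 1 + Z.of_nat k)%Z with (n + 1 + Z.of_nat k + r)%Z by ring. ring.
Qed.

(** * Weighted averages *)

Lemma weighted_average_le (a c x y : nat -> R) (w M : R) :
  (forall k, 0 < a k) -> (forall k, 0 < c k) ->
  (forall k, x k <= M) -> (forall k, y k <= M) ->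
  sums_to (fun k => a k * (x k - w) + c k * (y k - w)) 0 -> w <= M.
Proof.
  intros Ha Hc Hx Hy Hs. apply Rnot_lt_le. intros Hw.
  pose proof (sums_to_scal (-1) _ _ Hs) as Hm.
  assert (Hpos : forall k, 0 < -1 * (a k * (x k - w) + c k * (y k - w))).
  { intros k. pose proof (Ha k). pose proof (Hc k). pose proof (Hx k). pose proof (Hy k).
    assert (0 < a k * (w - x k)) by (apply Rmult_lt_0_compat; lra).
    assert (0 < c k * (w - y k)) by (apply Rmult_lt_0_compat; lra). lra. }
  pose proof (sums_to_ge_partial _ _ 1 (fun k => Rlt_le _ _ (Hpos k)) Hm) as H.
  cbn [bsum] in H. pose proof (Hpos 0%nat). lra.
Qed.

(** The deficits M - x and M - y are nonnegative and their weighted sum is (M - w) Om. Of this only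
    the first l terms with weights a are kept, each of relative weight at least q. *)
Lemma weighted_average_gain (a c x y : nat -> R) (w M Om q : R) (l : nat) :
  (forall k, 0 < a k) -> (forall k, 0 < c k) ->
  (forall k, x k <= M) -> (forall k, y k <= M) ->
  sums_to (fun k => a k * (x k - w) + c k * (y k - w)) 0 ->
  sums_to (fun k => a k + c k) Om -> 0 < Om ->
  (forall k, (k < l)%nat -> Om * q <= a k) ->
  w <= M - q * bsum (fun k => M - x k) l.
Proof.
  intros Ha Hc Hx Hy Hs HO HOm Hq.
  assert (H1 : sums_to (fun k => a k * (M - x k) + c k * (M - y k)) ((M - w) * Om)).
  { replace ((M - w) * Om) with ((M - w) * Om - 0) by ring.
    eapply sums_to_ext; [|apply sums_to_minus; [apply sums_to_scal, HO|exact Hs]].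
    intros k. simpl. ring. }
  assert (Hnn : forall k, 0 <= a k * (M - x k) + c k * (M - y k)).
  { intros k. pose proof (Ha k). pose proof (Hc k). pose proof (Hx k). pose proof (Hy k).
    assert (0 <= a k * (M - x k)) by (apply Rmult_le_pos; lra).
    assert (0 <= c k * (M - y k)) by (apply Rmult_le_pos; lra). lra. }
  pose proof (sums_to_ge_partial _ _ l Hnn H1) as H2.
  assert (H3 : Om * q * bsum (fun k => M - x k) l <=
               bsum (fun k => a k * (M - x k) + c k * (M - y k)) l).
  { rewrite <- bsum_scal. apply bsum_le. intros k Hk.
    pose proof (Hc k). pose proof (Hx k). pose proof (Hy k). pose proof (Hq k Hk).
    assert (0 <= c k * (M - y k)) by (apply Rmult_le_pos; lra).
    assert (Om * q * (M - x k) <= a k * (M - x k)) by (apply Rmult_le_compat_r; lra). lra. }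
  assert (H4 : Om * (q * bsum (fun k => M - x k) l) <= Om * (M - w)) by lra.
  apply Rmult_le_reg_l in H4; lra.
Qed.

Lemma sums_to_negate (a c x y : nat -> R) (w : R) :
  sums_to (fun k => a k * (x k - w) + c k * (y k - w)) 0 ->
  sums_to (fun k => a k * (- x k - - w) + c k * (- y k - - w)) 0.
Proof.
  intros Hs. rewrite <- (Rmult_0_r (-1)).
  eapply sums_to_ext; [|apply sums_to_scal, Hs]. intros k. simpl. ring.
Qed.

Lemma weighted_average_Rabs_le (a c x y : nat -> R) (w M : R) :
  (forall k, 0 < a k) -> (forall k, 0 < c k) ->
  (forall k, Rabs (x k) <= M) -> (forall k, Rabs (y k) <= M) ->
  sums_to (fun k => a k * (x k - w) + c k * (y k - w)) 0 -> Rabs w <= M.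
Proof.
  intros Ha Hc Hx Hy Hs. apply Rabs_le. split.
  - apply Ropp_le_cancel. rewrite Ropp_involutive.
    apply (weighted_average_le a c (fun k => - x k) (fun k => - y k)); auto.
    + intros k. pose proof (proj1 (Rabs_le_between _ _) (Hx k)). lra.
    + intros k. pose proof (proj1 (Rabs_le_between _ _) (Hy k)). lra.
    + apply sums_to_negate, Hs.
  - apply (weighted_average_le a c x y); auto.
    + intros k. apply (proj1 (Rabs_le_between _ _) (Hx k)).
    + intros k. apply (proj1 (Rabs_le_between _ _) (Hy k)).
Qed.

(** This is meant for x k that telescope: S then stays fixed while l M grows, so the gain is
    positive once l M exceeds S. *)
Lemma weighted_average_Rabs_gain (a c x y : nat -> R) (w M Om q S : R) (l : nat) :
  (forall k, 0 < a k) -> (forall k, 0 < c k) ->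
  (forall k, Rabs (x k) <= M) -> (forall k, Rabs (y k) <= M) ->
  sums_to (fun k => a k * (x k - w) + c k * (y k - w)) 0 ->
  sums_to (fun k => a k + c k) Om -> 0 < Om -> 0 <= q ->
  (forall k, (k < l)%nat -> Om * q <= a k) ->
  Rabs (bsum x l) <= S ->
  Rabs w <= M - q * (INR l * M - S).
Proof.
  intros Ha Hc Hx Hy Hs HO HOm Hq0 Hq HS.
  assert (HM : forall v : nat -> R, bsum (fun k => M - v k) l = INR l * M - bsum v l).
  { intros v. clear. induction l as [|l IH]; [simpl; ring|].
    rewrite S_INR. cbn [bsum]. rewrite IH. ring. }
  assert (HN : bsum (fun k => - x k) l = - bsum x l).
  { clear. induction l as [|l IH]; [simpl; ring|]. cbn [bsum]. rewrite IH. ring. }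
  apply (proj1 (Rabs_le_between _ _)) in HS.
  apply Rabs_le. split.
  - assert (H : - w <= M - q * bsum (fun k => M - - x k) l).
    { apply (weighted_average_gain a c (fun k => - x k) (fun k => - y k) (- w) M Om q l); auto.
      + intros k. pose proof (proj1 (Rabs_le_between _ _) (Hx k)). lra.
      + intros k. pose proof (proj1 (Rabs_le_between _ _) (Hy k)). lra.
      + apply sums_to_negate, Hs. }
    rewrite (HM (fun k => - x k)), HN in H. nra.
  - assert (H : w <= M - q * bsum (fun k => M - x k) l).
    { apply (weighted_average_gain a c x y w M Om q l); auto.
      + intros k. apply (proj1 (Rabs_le_between _ _) (Hx k)).
      + intros k. apply (proj1 (Rabs_le_between _ _) (Hy k)). }
    rewrite HM in H. nra.
Qed.

Lemma osc_critical (t s : Z -> R) (b e : R) :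
  increasing t -> critical t b s -> osc t e -> osc s e.
Proof.
  intros Ht Hc Ho n r.
  destruct (critical_shift t s b n r Ht Hc) as [Hom Hsum].
  eapply weighted_average_Rabs_le; [| | | |exact Hsum];
    intros k; solve [apply Hom | apply Ho].
Qed.

(* If [s n] were within 1/4 of [t n], every paired term of the defining series
   would be positive and the first one larger than 1. *)
Lemma critical_separated (t s : Z -> R) (b e : R) (n : Z) :
  osc t e -> e <= 1 / 10 -> Rabs b <= 1 -> critical t b s ->
  1 / 4 <= s n - t n /\ 1 / 4 <= t (n + 1)%Z - s n.
Proof.
  intros Ho He Hb Hc.
  destruct (Hc n) as [Hs Hsum].
  apply (proj1 (Rabs_le_between _ _)) in Hb.
  pose proof (osc_growth t e n 1 Ho He) as Hg. simpl in Hg.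
  assert (HPQ : forall k : nat,
    0 < s n - t (n - Z.of_nat k)%Z <= s n - t n + INR k + 1 / 10 /\
    INR k + 9 / 10 - (s n - t n) <= t (n + 1 + Z.of_nat k)%Z - s n /\
    0 < t (n + 1 + Z.of_nat k)%Z - s n <= t (n + 1)%Z - s n + INR k + 1 / 10 /\
    INR k + 9 / 10 - (t (n + 1)%Z - s n) <= s n - t (n - Z.of_nat k)%Z).
  { intros k. pose proof (pos_INR k).
    pose proof (osc_growth t e (n - Z.of_nat k) k Ho He) as H1.
    replace (n - Z.of_nat k + Z.of_nat k)%Z with n in H1 by ring.
    pose proof (osc_growth t e (n + 1) k Ho He) as H2.
    pose proof (Ho (n - Z.of_nat k)%Z (Z.of_nat k)) as H3.
    pose proof (Ho (n - Z.of_nat k)%Z (Z.of_nat k + 1)%Z) as H4.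
    pose proof (Ho n (1 + Z.of_nat k)%Z) as H5.
    pose proof (Ho (n + 1)%Z (Z.of_nat k)) as H6.
    rewrite ?plus_IZR, <- ?INR_IZR_INZ in *.
    replace (n - Z.of_nat k + Z.of_nat k)%Z with n in H3 by ring.
    replace (n - Z.of_nat k + (Z.of_nat k + 1))%Z with (n + 1)%Z in H4 by ring.
    replace (n + (1 + Z.of_nat k))%Z with (n + 1 + Z.of_nat k)%Z in H5 by ring.
    apply (proj1 (Rabs_le_between _ _)) in H3, H4, H5, H6.
    repeat split; lra. }
  assert (Hterm : forall k, pterm t n (s n) k =
    / (s n - t (n - Z.of_nat k)%Z) - / (t (n + 1 + Z.of_nat k)%Z - s n)).
  { intros k. unfold pterm. destruct (HPQ k) as [? [? [? ?]]]. field; lra. }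
  assert (H0 : pterm t n (s n) 0 = / (s n - t n) - / (t (n + 1)%Z - s n)).
  { rewrite Hterm. simpl. rewrite Z.sub_0_r, Z.add_0_r. reflexivity. }
  split; apply Rnot_lt_le; intros Hlt.
  - assert (Hpos : forall k, 0 <= pterm t n (s n) k).
    { intros k. rewrite Hterm. destruct (HPQ k) as [? [? [? ?]]].
      assert (/ (t (n + 1 + Z.of_nat k)%Z - s n) <= / (s n - t (n - Z.of_nat k)%Z));
        [apply Rinv_le_contravar; lra|lra]. }
    pose proof (sums_to_ge_partial _ _ 1 Hpos Hsum) as H. cbn [bsum] in H. rewrite H0 in H.
    assert (4 < / (s n - t n)).
    { replace 4 with (/ (1 / 4)) by field. apply Rinv_lt_contravar; nra. }
    assert (/ (t (n + 1)%Z - s n) <= 2).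
    { replace 2 with (/ (1 / 2)) by field. apply Rinv_le_contravar; lra. }
    lra.
  - assert (Hpos : forall k, 0 <= -1 * pterm t n (s n) k).
    { intros k. rewrite Hterm. destruct (HPQ k) as [? [? [? ?]]].
      assert (/ (s n - t (n - Z.of_nat k)%Z) <= / (t (n + 1 + Z.of_nat k)%Z - s n));
        [apply Rinv_le_contravar; lra|lra]. }
    pose proof (sums_to_ge_partial _ _ 1 Hpos (sums_to_scal (-1) _ _ Hsum)) as H.
    cbn [bsum] in H. rewrite H0 in H.
    assert (4 < / (t (n + 1)%Z - s n)).
    { replace 4 with (/ (1 / 4)) by field. apply Rinv_lt_contravar; nra. }
    assert (/ (s n - t n) <= 2).
    { replace 2 with (/ (1 / 2)) by field. apply Rinv_le_contravar; lra. }
    lra.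
Qed.

(** The weights lie between 1/4 and 16 times [inv_sq], so their total is at most 64, while each of
    the l weights at indices n, n - 1, ... is at least 1/(4 l^2). The quotient of these two bounds
    is 1/(256 l^2). *)
Lemma gap_critical (t s : Z -> R) (b e M : R) (l : nat) :
  osc t e -> e <= 1 / 10 -> Rabs b <= 1 -> critical t b s ->
  (forall m, Rabs (t (m + 1)%Z - t m - 1) <= M) -> (1 <= l)%nat ->
  forall n, Rabs (s (n + 1)%Z - s n - 1) <=
    M - / (256 * INR l ^ 2) * (INR l * M - e).
Proof.
  intros Ho He Hb Hc HM Hl n.
  assert (Ht : increasing t) by (apply (osc_increasing t e); auto).
  destruct (critical_shift t s b n 1 Ht Hc) as [Hom Hsum]. cbv zeta in Hsum.
  set (om := fun m => / ((s n - t m) * (s (n + 1)%Z - t (m + 1)%Z))) in *.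
  assert (HA : forall p (k : nat),
    1 / 4 * (INR k + 1) <= s p - t (p - Z.of_nat k)%Z <= 2 * (INR k + 1) /\
    1 / 4 * (INR k + 1) <= t (p + 1 + Z.of_nat k)%Z - s p <= 2 * (INR k + 1)).
  { clear Hsum Hom om n. intros p k. pose proof (pos_INR k).
    pose proof (critical_separated t s b e p Ho He Hb Hc).
    pose proof (osc_growth t e p 1 Ho He) as Hg. simpl in Hg.
    pose proof (osc_growth t e (p - Z.of_nat k) k Ho He) as H1.
    replace (p - Z.of_nat k + Z.of_nat k)%Z with p in H1 by ring.
    pose proof (osc_growth t e (p + 1) k Ho He) as H2. lra. }
  assert (Hinv : forall (k : nat) x, 1 / 16 * (INR k + 1) ^ 2 <= x <= 4 * (INR k + 1) ^ 2 ->
    1 / 4 * inv_sq k <= / x <= 16 * inv_sq k).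
  { intros k x Hx. pose proof (pos_INR k). unfold inv_sq.
    replace (1 / 4 * / (INR k + 1) ^ 2) with (/ (4 * (INR k + 1) ^ 2)) by (field; lra).
    replace (16 * / (INR k + 1) ^ 2) with (/ (1 / 16 * (INR k + 1) ^ 2)) by (field; lra).
    split; apply Rinv_le_contravar; nra. }
  assert (Hom1 : forall k : nat, 1 / 4 * inv_sq k <= om (n - Z.of_nat k)%Z <= 16 * inv_sq k).
  { intros k. apply Hinv. pose proof (pos_INR k).
    destruct (HA n k) as [H1 _]. destruct (HA (n + 1)%Z k) as [H2 _].
    replace (n + 1 - Z.of_nat k)%Z with (n - Z.of_nat k + 1)%Z in H2 by ring. nra. }
  assert (Hom2 : forall k : nat, 1 / 4 * inv_sq k <= om (n + 1 + Z.of_nat k)%Z <= 16 * inv_sq k).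
  { intros k. apply Hinv. pose proof (pos_INR k).
    destruct (HA n k) as [_ H1]. destruct (HA (n + 1)%Z k) as [_ H2].
    replace (n + 1 + 1 + Z.of_nat k)%Z with (n + 1 + Z.of_nat k + 1)%Z in H2 by ring. nra. }
  set (a := fun k : nat => om (n - Z.of_nat k)%Z) in *.
  set (c := fun k : nat => om (n + 1 + Z.of_nat k)%Z) in *.
  assert (Hac : forall k, Rabs (a k + c k) <= 32 * inv_sq k).
  { intros k. pose proof (Hom1 k). pose proof (Hom2 k). pose proof (sq_pos k).
    unfold a, c. rewrite Rabs_pos_eq; lra. }
  destruct (sums_to_decay _ _ Hac) as [Om HOm].
  assert (HOm1 : 0 < Om <= 64).
  { split.
    - apply Rlt_le_trans with (bsum (fun k => a k + c k) 1).
      + cbn [bsum]. pose proof (Hom1 O). pose proof (Hom2 O). pose proof (sq_pos 0).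
        unfold a, c. lra.
      + apply sums_to_ge_partial; [|exact HOm].
        intros k. pose proof (Hom1 k). pose proof (Hom2 k). pose proof (sq_pos k).
        unfold a, c. lra.
    - apply (sums_to_le _ _ 64) in HOm; [exact HOm|]. intros j.
      eapply Rle_trans; [apply bsum_le; intros k _; eapply Rle_trans; [apply Rle_abs|apply Hac]|].
      rewrite bsum_scal. pose proof (bsum_sq_le j). lra. }
  assert (Hlpos : 1 <= INR l) by (replace 1 with (INR 1) by reflexivity; apply le_INR; lia).
  eapply (weighted_average_Rabs_gain a c
    (fun k => t (n - Z.of_nat k + 1)%Z - t (n - Z.of_nat k)%Z - 1)
    (fun k => t (n + 1 + Z.of_nat k + 1)%Z - t (n + 1 + Z.of_nat k)%Z - 1) _ M Om);
    [intros; apply Hom|intros; apply Hom|intros; apply HM|intros; apply HM|exact Hsum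
    |exact HOm|lra| | |].
  - left. apply Rinv_0_lt_compat. nra.
  - intros k Hk. apply Rle_trans with (1 / 4 * inv_sq k); [|apply Hom1].
    apply Rle_trans with (64 * / (256 * INR l ^ 2)).
    + apply Rmult_le_compat_r; [left; apply Rinv_0_lt_compat; nra|lra].
    + replace (64 * / (256 * INR l ^ 2)) with (1 / 4 * / INR l ^ 2) by (field; lra).
      apply Rmult_le_compat_l; [lra|]. unfold inv_sq.
      assert (INR k + 1 <= INR l) by (rewrite <- S_INR; apply le_INR; lia).
      pose proof (pos_INR k). apply Rinv_le_contravar; [nra|]. apply pow_incr. lra.
  (* The deviations of l consecutive gaps telescope to one long difference, which [osc] bounds by e
     whatever l is. *)
  - assert (HB : bsum (fun k => t (n - Z.of_nat k + 1)%Z - t (n - Z.of_nat k)%Z - 1) l =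
      t (n + 1 - Z.of_nat l + Z.of_nat l)%Z - t (n + 1 - Z.of_nat l)%Z - IZR (Z.of_nat l)).
    { rewrite <- INR_IZR_INZ. clear.
      replace (n + 1 - Z.of_nat l + Z.of_nat l)%Z with (n + 1)%Z by ring.
      induction l as [|l IH].
      - simpl. rewrite Z.sub_0_r. ring.
      - cbn [bsum]. rewrite IH, S_INR, Nat2Z.inj_succ. unfold Z.succ.
        replace (n - Z.of_nat l + 1)%Z with (n + 1 - Z.of_nat l)%Z by ring.
        replace (n + 1 - (Z.of_nat l + 1))%Z with (n - Z.of_nat l)%Z by ring. ring. }
    rewrite HB. apply Ho.
Qed.

(** The constant 8192 closes the induction. For S j < 512 the bound e is already small enough.
    Otherwise, with J = j + 1 and 512 l <= J <= 1024 l, the gain of [gap_critical] is at least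
    (16384 - 4096) e / J^2, while the bound has to drop by at most 8192 e / J^2. *)
Lemma gap_decay (T : nat -> Z -> R) (b e : R) (j : nat) :
  0 < e <= 1 / 10 -> Rabs b <= 1 -> osc (T O) e ->
  (forall i, (i < j)%nat -> critical (T i) b (T (S i))) ->
  osc (T j) e /\
  forall n, Rabs (T j (n + 1)%Z - T j n - 1) <= 8192 * e / (INR j + 1).
Proof.
  intros He Hb H0. induction j as [|j IH]; intros Hc.
  - split; [exact H0|]. intros n. pose proof (H0 n 1%Z). simpl. lra.
  - destruct (IH ltac:(intros; apply Hc; lia)) as [Ho Hg].
    specialize (Hc j ltac:(lia)).
    assert (Ho' : osc (T (S j)) e).
    { apply (osc_critical (T j) _ b); auto. apply (osc_increasing _ e); [exact Ho|lra]. }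
    split; [exact Ho'|]. intros n. rewrite S_INR.
    pose proof (pos_INR j) as Hj0.
    destruct (Nat.lt_ge_cases (S j) 512) as [Hj|Hj].
    + eapply Rle_trans; [apply (Ho' n 1%Z)|].
      apply Rmult_le_reg_r with (INR j + 1 + 1); [lra|].
      unfold Rdiv. rewrite Rmult_assoc, Rinv_l, Rmult_1_r by lra.
      assert (INR j <= INR 511) by (apply le_INR; lia).
      replace (INR 511) with 511 in * by (rewrite INR_IZR_INZ; reflexivity). nra.
    + (* 512 is twice the reciprocal of the gain constant 1/256 in [gap_critical]. *)
      set (l := (S j / 512)%nat).
      assert (Hl : (1 <= l)%nat) by (apply Nat.div_le_lower_bound; lia).
      pose proof (Nat.div_mod_eq (S j) 512) as Hd. fold l in Hd.
      pose proof (Nat.mod_upper_bound (S j) 512 ltac:(lia)) as Hm.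
      pose proof (gap_critical (T j) (T (S j)) b e _ l Ho ltac:(lra) Hb Hc Hg Hl n) as H.
      eapply Rle_trans; [exact H|]. clear H.
      assert (Hl1 : 512 * INR l <= INR j + 1).
      { rewrite <- S_INR. replace 512 with (INR 512) by (rewrite INR_IZR_INZ; reflexivity).
        rewrite <- mult_INR. apply le_INR. lia. }
      assert (Hl2 : INR j + 1 <= 1024 * INR l).
      { rewrite <- S_INR. replace 1024 with (INR 1024) by (rewrite INR_IZR_INZ; reflexivity).
        rewrite <- mult_INR. apply le_INR. lia. }
      assert (Hl3 : 1 <= INR l) by (replace 1 with (INR 1) by reflexivity; apply le_INR; lia).
      set (L := INR l) in *. set (J := INR j + 1) in *.
      assert (HJ : 0 < J) by (unfold J; lra).
      replace (8192 * e / J - / (256 * L ^ 2) * (L * (8192 * e / J) - e))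
        with (8192 * e / J - 32 * e / (L * J) + e / (256 * L ^ 2)) by (field; lra).
      assert (H1 : 512 * / J <= / L).
      { apply Rmult_le_reg_l with (L * J); [nra|].
        replace (L * J * (512 * / J)) with (512 * L) by (field; lra).
        replace (L * J * / L) with J by (field; lra). lra. }
      assert (H2 : / L <= 1024 * / J).
      { apply Rmult_le_reg_l with (L * J); [nra|].
        replace (L * J * (1024 * / J)) with (1024 * L) by (field; lra).
        replace (L * J * / L) with J by (field; lra). lra. }
      assert (HiJ : 0 < / J) by (apply Rinv_0_lt_compat, HJ).
      assert (H3 : / (J + 1) >= / J - / J * / J).
      { apply Rle_ge. apply Rmult_le_reg_l with (J * J * (J + 1)); [nra|].
        replace (J * J * (J + 1) * (/ J - / J * / J)) with (J * J - 1) by (field; lra).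
        replace (J * J * (J + 1) * / (J + 1)) with (J * J) by (field; lra). lra. }
      replace (8192 * e / J - 32 * e / (L * J) + e / (256 * L ^ 2))
        with (e * (8192 * / J - 32 * (/ L * / J) + / 256 * (/ L * / L))) by (field; lra).
      replace (8192 * e / (J + 1)) with (e * (8192 * / (J + 1))) by (field; lra).
      apply Rmult_le_compat_l; [lra|].
      set (iL := / L) in *. set (iJ := / J) in *.
      assert (512 * iJ * iJ <= iL * iJ) by nra.
      assert (iL * iL <= 1024 * 1024 * (iJ * iJ)) by nra.
      nra.
Qed.

(** * Zeros of the logarithmic derivative *)

(** Boundedness without smallness, for the existence and convergence statements; interlacing zeros
    satisfy it with A + 1. *)
Definition drift (t : Z -> R) (A : R) : Prop := forall m : Z, Rabs (t m - IZR m) <= A.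

(** F decreases at least as fast as 1/(x - p) and as -1/(q - x), hence runs from +infinity at p to
    -infinity at q. The abstract form serves both the full principal value and its truncations. *)
Lemma monotone_root (F : R -> R) (p q v : R) :
  p < q ->
  (forall x y, p < x -> x < y -> y < q ->
     / (x - p) - / (y - p) <= F x - F y /\ / (q - y) - / (q - x) <= F x - F y) ->
  (forall g, 0 < g -> exists L, forall x y,
     p + g <= x <= q - g -> p + g <= y <= q - g -> Rabs (F x - F y) <= L * Rabs (x - y)) ->
  exists s, p < s < q /\ F s = v.
Proof.
  intros Hpq HF HL.
  set (m := (p + q) / 2). set (h := m - p).
  assert (Hh : 0 < h) by (unfold h, m; lra).
  assert (Hih : 0 < / h) by (apply Rinv_0_lt_compat, Hh).
  (* At distance 1 / B from an end, F differs from F m by at least B - 1 / h = |v| + |F m| + 1,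
     hence has passed v. *)
  set (B := Rabs v + Rabs (F m) + / h + 1).
  pose proof (Rabs_pos v). pose proof (Rabs_pos (F m)).
  pose proof (Rle_abs v). pose proof (Rle_abs (F m)).
  pose proof (Rle_abs (- v)) as Hv. pose proof (Rle_abs (- F m)) as Hm.
  rewrite Rabs_Ropp in Hv, Hm.
  set (g := / B).
  assert (HB : 0 < B) by (unfold B; lra).
  assert (Hg : 0 < g) by (apply Rinv_0_lt_compat, HB).
  assert (Hgh : g < h).
  { unfold g. rewrite <- (Rinv_inv h). apply Rinv_lt_contravar; [nra|unfold B; lra]. }
  assert (Hig : / g = B) by apply Rinv_inv.
  assert (Hx : v < F (p + g)).
  { destruct (HF (p + g) m) as [H3 _]; [lra|unfold h in *; lra|unfold m; lra|].
    replace (p + g - p) with g in H3 by ring. fold h in H3. rewrite Hig in H3. unfold B in H3. lra. }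
  assert (Hy : F (q - g) < v).
  { destruct (HF m (q - g)) as [_ H3]; [unfold m; lra|unfold h, m in *; lra|lra|].
    replace (q - (q - g)) with g in H3 by ring.
    replace (q - m) with h in H3 by (unfold h, m; field).
    rewrite Hig in H3. unfold B in H3. lra. }
  (* [IVT_interv] asks for two-sided continuity at the end points too, hence a Lipschitz bound on
     the larger interval with margin g / 2. *)
  destruct (HL (g / 2)) as [L HL2]; [lra|].
  destruct (IVT_interv (fun x => v - F x) (p + g) (q - g)) as [s [Hs1 Hs2]].
  - intros a Ha eps Heps.
    pose proof (Rabs_pos L) as HLp.
    exists (Rmin (g / 2) (eps / (Rabs L + 1))). split.
    + apply Rmin_pos; [lra|]. apply Rdiv_lt_0_compat; lra.
    + intros x [_ Hd]. simpl in *. unfold Rdist in *.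
      pose proof (Rmin_l (g / 2) (eps / (Rabs L + 1))).
      pose proof (Rmin_r (g / 2) (eps / (Rabs L + 1))).
      assert (Hd' : Rabs (x - a) < g / 2) by lra. apply Rabs_def2 in Hd'.
      replace (v - F x - (v - F a)) with (- (F x - F a)) by ring.
      rewrite Rabs_Ropp.
      eapply Rle_lt_trans; [apply HL2; lra|].
      apply Rle_lt_trans with (Rabs L * Rabs (x - a)).
      * apply Rmult_le_compat_r; [apply Rabs_pos|apply Rle_abs].
      * assert (Hd2 : Rabs (x - a) < eps / (Rabs L + 1)) by lra.
        apply (Rmult_lt_compat_r (Rabs L + 1)) in Hd2; [|lra].
        replace (eps / (Rabs L + 1) * (Rabs L + 1)) with eps in Hd2 by (field; lra).
        pose proof (Rabs_pos (x - a)). nra.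
  - unfold h, m in *. lra.
  - lra.
  - lra.
  - exists s. split; lra.
Qed.

Lemma gap_sign (t : Z -> R) (n i : Z) (x : R) :
  increasing t -> t n < x < t (n + 1)%Z ->
  ((i <= n)%Z /\ t i <= t n) \/ ((n + 1 <= i)%Z /\ t (n + 1)%Z <= t i).
Proof.
  intros Ht Hx. destruct (Z_le_gt_dec i n); [left|right].
  - split; [lia|]. apply increasing_le; auto.
  - split; [lia|]. apply increasing_le; [auto|lia].
Qed.

Lemma inv_diff_pos (t : Z -> R) (n i : Z) (x y : R) :
  increasing t -> t n < x < t (n + 1)%Z -> t n < y < t (n + 1)%Z ->
  0 < (x - t i) * (y - t i) /\
  / (x - t i) - / (y - t i) = (y - x) * / ((x - t i) * (y - t i)).
Proof.
  intros Ht Hx Hy.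
  destruct (gap_sign t n i x Ht Hx) as [[_ H]|[_ H]]; (split; [nra|field; lra]).
Qed.

(** Minus the divided difference of [pterm] between x and y; both summands are positive when x and y
    lie in the same gap. *)
Definition pweight (t : Z -> R) (n : Z) (x y : R) (k : nat) : R :=
  / ((x - t (n - Z.of_nat k)%Z) * (y - t (n - Z.of_nat k)%Z)) +
  / ((x - t (n + 1 + Z.of_nat k)%Z) * (y - t (n + 1 + Z.of_nat k)%Z)).

Lemma pterm_diff (t : Z -> R) (n m : Z) (x y : R) (k : nat) :
  increasing t -> t n < x < t (n + 1)%Z -> t n < y < t (n + 1)%Z ->
  pterm t m x k - pterm t m y k = (y - x) * pweight t m x y k /\
  0 < / ((x - t (m - Z.of_nat k)%Z) * (y - t (m - Z.of_nat k)%Z)) /\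
  0 < / ((x - t (m + 1 + Z.of_nat k)%Z) * (y - t (m + 1 + Z.of_nat k)%Z)).
Proof.
  intros Ht Hx Hy. unfold pterm, pweight.
  destruct (inv_diff_pos t n (m - Z.of_nat k)%Z x y Ht Hx Hy) as [H1 H2].
  destruct (inv_diff_pos t n (m + 1 + Z.of_nat k)%Z x y Ht Hx Hy) as [H3 H4].
  repeat split; try (apply Rinv_0_lt_compat; assumption).
  rewrite Rmult_plus_distr_l, <- H2, <- H4. ring.
Qed.

(** If D >= g and D >= k - 2 A, then k + 1 <= D + (2 A + 1)(D / g). This one bound covers the small
    k, where only g helps, as well as the large ones. *)
Lemma pair_distance (t : Z -> R) (A g x : R) (n : Z) (k : nat) :
  increasing t -> drift t A -> 0 < g -> t n + g <= x <= t (n + 1)%Z - g ->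
  INR k + 1 <= (g + 2 * A + 1) / g * (x - t (n - Z.of_nat k)%Z) /\
  INR k + 1 <= (g + 2 * A + 1) / g * (t (n + 1 + Z.of_nat k)%Z - x) /\
  g <= x - t (n - Z.of_nat k)%Z /\ g <= t (n + 1 + Z.of_nat k)%Z - x.
Proof.
  intros Ht HA Hg Hx.
  assert (HA0 : 0 <= A) by (eapply Rle_trans; [apply Rabs_pos|apply (HA 0%Z)]).
  pose proof (increasing_le t (n - Z.of_nat k) n Ht ltac:(lia)).
  pose proof (increasing_le t (n + 1) (n + 1 + Z.of_nat k) Ht ltac:(lia)).
  pose proof (HA n) as H1. pose proof (HA (n + 1)%Z) as H2.
  pose proof (HA (n - Z.of_nat k)%Z) as H3. pose proof (HA (n + 1 + Z.of_nat k)%Z) as H4.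
  rewrite ?minus_IZR, ?plus_IZR, <- ?INR_IZR_INZ in *.
  apply (proj1 (Rabs_le_between _ _)) in H1, H2, H3, H4.
  assert (HD : forall D, g <= D -> INR k - 2 * A <= D -> INR k + 1 <= (g + 2 * A + 1) / g * D).
  { intros D HD1 HD2.
    replace ((g + 2 * A + 1) / g * D) with (D + (2 * A + 1) * (D / g)) by (field; lra).
    assert (1 <= D / g) by (apply Rle_div_r; lra). nra. }
  repeat split; [apply HD|apply HD| |]; lra.
Qed.

(** Each reciprocal alone is only O(1/k). The two zeros are almost symmetric about x, so in the
    common fraction the numerator stays within 4 A + 1 while the denominator grows like k^2. *)
Lemma pterm_decay (t : Z -> R) (A g x : R) (n : Z) (k : nat) :
  increasing t -> drift t A -> 0 < g -> t n + g <= x <= t (n + 1)%Z - g ->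
  Rabs (pterm t n x k) <= (4 * A + 1) * ((g + 2 * A + 1) / g) ^ 2 * inv_sq k.
Proof.
  intros Ht HA Hg Hx.
  destruct (pair_distance t A g x n k Ht HA Hg Hx) as [H1 [H2 [H3 H4]]].
  pose proof (HA n) as H5. pose proof (HA (n + 1)%Z) as H6.
  pose proof (HA (n - Z.of_nat k)%Z) as H7. pose proof (HA (n + 1 + Z.of_nat k)%Z) as H8.
  rewrite ?minus_IZR, ?plus_IZR, <- ?INR_IZR_INZ in *.
  apply (proj1 (Rabs_le_between _ _)) in H5, H6, H7, H8.
  unfold pterm. pose proof (pos_INR k).
  set (K := (g + 2 * A + 1) / g) in *.
  set (P := x - t (n - Z.of_nat k)%Z) in *. set (Q := t (n + 1 + Z.of_nat k)%Z - x) in *.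
  replace (x - t (n + 1 + Z.of_nat k)%Z) with (- Q) by (unfold Q; ring).
  replace (/ P + / - Q) with ((Q - P) * / (P * Q)) by (field; lra).
  rewrite Rabs_mult, Rmult_assoc. apply Rmult_le_compat; try apply Rabs_pos.
  - apply Rabs_le. unfold P, Q. split; lra.
  - rewrite Rabs_pos_eq by (left; apply Rinv_0_lt_compat; nra).
    unfold inv_sq. assert (0 < P * Q) by nra.
    apply Rmult_le_reg_l with (P * Q); [assumption|].
    rewrite Rinv_r by lra.
    apply Rmult_le_reg_r with ((INR k + 1) ^ 2); [nra|].
    replace (P * Q * (K ^ 2 * / (INR k + 1) ^ 2) * (INR k + 1) ^ 2) with ((K * P) * (K * Q))
      by (field; lra).
    nra.
Qed.

Lemma pweight_decay (t : Z -> R) (A g x y : R) (n : Z) (k : nat) :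
  increasing t -> drift t A -> 0 < g ->
  t n + g <= x <= t (n + 1)%Z - g -> t n + g <= y <= t (n + 1)%Z - g ->
  0 <= pweight t n x y k <= 2 * ((g + 2 * A + 1) / g) ^ 2 * inv_sq k.
Proof.
  intros Ht HA Hg Hx Hy.
  destruct (pair_distance t A g x n k Ht HA Hg Hx) as [H1 [H2 [H3 H4]]].
  destruct (pair_distance t A g y n k Ht HA Hg Hy) as [H5 [H6 [H7 H8]]].
  unfold pweight. pose proof (pos_INR k).
  set (K := (g + 2 * A + 1) / g) in *.
  assert (Hinv : forall P Q, g <= P -> g <= Q -> INR k + 1 <= K * P -> INR k + 1 <= K * Q ->
    0 <= / (P * Q) <= K ^ 2 * inv_sq k).
  { intros P Q HP HQ HKP HKQ. assert (0 < P * Q) by nra. split.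
    - left. apply Rinv_0_lt_compat. assumption.
    - unfold inv_sq. apply Rmult_le_reg_l with (P * Q); [assumption|].
      rewrite Rinv_r by lra.
      apply Rmult_le_reg_r with ((INR k + 1) ^ 2); [nra|].
      replace (P * Q * (K ^ 2 * / (INR k + 1) ^ 2) * (INR k + 1) ^ 2) with ((K * P) * (K * Q))
        by (field; lra).
      nra. }
  pose proof (Hinv _ _ H3 H7 H1 H5). pose proof (Hinv _ _ H4 H8 H2 H6).
  replace ((x - t (n + 1 + Z.of_nat k)%Z) * (y - t (n + 1 + Z.of_nat k)%Z))
    with ((t (n + 1 + Z.of_nat k)%Z - x) * (t (n + 1 + Z.of_nat k)%Z - y)) by ring.
  lra.
Qed.

Lemma gap_margin (p q x : R) : p < x < q -> exists g, 0 < g /\ p + g <= x <= q - g.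
Proof.
  intros Hx. exists (Rmin (x - p) (q - x)).
  pose proof (Rmin_l (x - p) (q - x)). pose proof (Rmin_r (x - p) (q - x)).
  split; [apply Rmin_pos|]; lra.
Qed.

Lemma pterm_sums (t : Z -> R) (A x : R) (n : Z) :
  increasing t -> drift t A -> t n < x < t (n + 1)%Z -> exists l, sums_to (pterm t n x) l.
Proof.
  intros Ht HA Hx. destruct (gap_margin _ _ _ Hx) as [g [Hg Hxg]].
  eapply sums_to_decay. intros k. apply (pterm_decay t A g); auto.
Qed.

Lemma critical_exists_at (t : Z -> R) (A b : R) (n : Z) :
  increasing t -> drift t A ->
  exists s, t n < s < t (n + 1)%Z /\ sums_to (pterm t n s) (- b).
Proof.
  intros Ht HA.
  assert (HA0 : 0 <= A) by (eapply Rle_trans; [apply Rabs_pos|apply (HA 0%Z)]).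
  (* The limit is meaningful inside the gap, and [monotone_root] evaluates [F] only there. *)
  set (F := fun x => real (Lim_seq (bsum (pterm t n x)))).
  assert (HF : forall x, t n < x < t (n + 1)%Z -> sums_to (pterm t n x) (F x)).
  { intros x Hx. destruct (pterm_sums t A x n Ht HA Hx) as [l Hl].
    unfold F. rewrite (is_lim_seq_unique _ _ Hl). exact Hl. }
  assert (HD : forall x y, t n < x < t (n + 1)%Z -> t n < y < t (n + 1)%Z ->
    sums_to (fun k => (y - x) * pweight t n x y k) (F x - F y)).
  { intros x y Hx Hy. eapply sums_to_ext; [|apply sums_to_minus; apply HF; assumption].
    intros k. apply (pterm_diff t n n x y k Ht Hx Hy). }
  destruct (monotone_root F (t n) (t (n + 1)%Z) (- b)) as [s [Hs1 Hs2]].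
  - apply Ht.
  - intros x y H1 H2 H3.
    assert (Hx : t n < x < t (n + 1)%Z) by lra. assert (Hy : t n < y < t (n + 1)%Z) by lra.
    assert (Hnn : forall k, 0 <= (y - x) * pweight t n x y k).
    { intros k. destruct (pterm_diff t n n x y k Ht Hx Hy) as [_ [Ha Hb]].
      unfold pweight. apply Rmult_le_pos; lra. }
    pose proof (sums_to_ge_partial _ _ 1 Hnn (HD x y Hx Hy)) as H.
    destruct (pterm_diff t n n x y 0 Ht Hx Hy) as [_ [Ha Hb]].
    cbn [bsum] in H. unfold pweight in *. simpl in *.
    rewrite Z.sub_0_r, Z.add_0_r in *.
    replace (/ (x - t n) - / (y - t n)) with ((y - x) * / ((x - t n) * (y - t n))) by (field; lra).
    replace (/ (t (n + 1)%Z - y) - / (t (n + 1)%Z - x))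
      with ((y - x) * / ((x - t (n + 1)%Z) * (y - t (n + 1)%Z))) by (field; lra).
    split; nra.
  - intros g Hg. exists (4 * ((g + 2 * A + 1) / g) ^ 2). intros x y Hx Hy.
    apply (sums_to_Rabs_le (fun k => (y - x) * pweight t n x y k)).
    + intros j.
      eapply Rle_trans; [apply (bsum_decay _ (Rabs (x - y) * (2 * ((g + 2 * A + 1) / g) ^ 2)))|].
      * intros k _. destruct (pweight_decay t A g x y n k Ht HA Hg Hx Hy) as [Hw1 Hw2].
        rewrite Rabs_mult, Rabs_minus_sym, Rmult_assoc.
        apply Rmult_le_compat_l; [apply Rabs_pos|]. rewrite Rabs_pos_eq; assumption.
      * apply Rmult_le_pos; [apply Rabs_pos|]. pose proof (pow2_ge_0 ((g + 2 * A + 1) / g)). lra.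
      * lra.
    + apply HD; lra.
  - exists s. split; [exact Hs1|]. rewrite <- Hs2. apply HF, Hs1.
Qed.

(** * Recentering and truncating the principal value *)

Lemma inv_lim_0 (u : nat -> R) (B : R) :
  (forall n, INR n - B <= Rabs (u n)) -> is_lim_seq (fun n => / u n) 0.
Proof.
  intros Hu. apply is_lim_seq_abs_0.
  apply (is_lim_seq_le_le_loc (fun _ => 0) _ (fun n => / (INR n - B))).
  - destruct (nfloor_ex (Rabs B)) as [N [_ HN]]; [apply Rabs_pos|].
    pose proof (Rle_abs B).
    exists (S N). intros n Hn. apply le_INR in Hn. rewrite S_INR in Hn.
    specialize (Hu n). rewrite Rabs_inv. split.
    + left. apply Rinv_0_lt_compat. lra.
    + apply Rinv_le_contravar; lra.
  - apply is_lim_seq_const.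
  - apply (is_lim_seq_inv (fun n => INR n - B) p_infty).
    + apply is_lim_seq_minus with p_infty B; [apply is_lim_seq_INR|apply is_lim_seq_const|].
      reflexivity.
    + discriminate.
Qed.

Lemma drift_far (t : Z -> R) (A x : R) (c : Z) (n : nat) : drift t A ->
  INR n - (A + Rabs (IZR c) + Rabs x) <= Rabs (x - t (c + Z.of_nat n)%Z) /\
  INR n - (A + Rabs (IZR c) + Rabs x) <= Rabs (x - t (c - Z.of_nat n)%Z).
Proof.
  intros HA.
  pose proof (HA (c + Z.of_nat n)%Z) as H1. pose proof (HA (c - Z.of_nat n)%Z) as H2.
  rewrite minus_IZR, plus_IZR, <- INR_IZR_INZ in *.
  unfold Rabs in *. repeat destruct Rcase_abs; lra.
Qed.

(** Moving the centre by one exchanges two boundary terms of the partial sum, both of which tend to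
    0. The equations in [critical] are centred at n, the products at 0. *)
Lemma pterm_recenter (t : Z -> R) (A x l : R) (n m : Z) :
  drift t A -> sums_to (pterm t n x) l -> sums_to (pterm t m x) l.
Proof.
  intros HA.
  assert (Hdiff : forall c N, bsum (pterm t (c + 1) x) N - bsum (pterm t c x) N =
    / (x - t (c + 1 + Z.of_nat N)%Z) - / (x - t (c + 1 - Z.of_nat N)%Z)).
  { intros c. induction N as [|N IH].
    - simpl. rewrite Z.add_0_r, Z.sub_0_r. ring.
    - cbn [bsum].
      replace (bsum (pterm t (c + 1) x) N) with
        (bsum (pterm t c x) N + (/ (x - t (c + 1 + Z.of_nat N)%Z) - / (x - t (c + 1 - Z.of_nat N)%Z)))
        by (rewrite <- IH; ring).
      unfold pterm. rewrite Nat2Z.inj_succ. unfold Z.succ.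
      replace (c + 1 - (Z.of_nat N + 1))%Z with (c - Z.of_nat N)%Z by ring.
      replace (c + 1 + (Z.of_nat N + 1))%Z with (c + 1 + 1 + Z.of_nat N)%Z by ring. ring. }
  assert (Hlim : forall c, is_lim_seq (fun N => bsum (pterm t (c + 1) x) N - bsum (pterm t c x) N) 0).
  { intros c.
    apply is_lim_seq_ext with (fun N => / (x - t (c + 1 + Z.of_nat N)%Z) - / (x - t (c + 1 - Z.of_nat N)%Z)).
    - intros N. symmetry. apply Hdiff.
    - replace (Finite 0) with (Finite (0 - 0)) by (f_equal; ring).
      apply is_lim_seq_minus'; apply (inv_lim_0 _ (A + Rabs (IZR (c + 1)) + Rabs x));
        intros N; apply (drift_far t A x (c + 1) N HA). }
  assert (Hup : forall c, sums_to (pterm t c x) l <-> sums_to (pterm t (c + 1) x) l).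
  { intros c. split; intros H.
    - apply is_lim_seq_ext with
        (fun N => bsum (pterm t c x) N + (bsum (pterm t (c + 1) x) N - bsum (pterm t c x) N));
        [intros; ring|].
      replace l with (l + 0) by ring. apply is_lim_seq_plus'; [exact H|apply Hlim].
    - apply is_lim_seq_ext with
        (fun N => bsum (pterm t (c + 1) x) N - (bsum (pterm t (c + 1) x) N - bsum (pterm t c x) N));
        [intros; ring|].
      replace l with (l - 0) by ring. apply is_lim_seq_minus'; [exact H|apply Hlim]. }
  assert (H0 : forall c, sums_to (pterm t 0 x) l <-> sums_to (pterm t c x) l).
  { intros c. pattern c. apply Z.bi_induction.
    - intros ? ? ->. reflexivity.
    - reflexivity.
    - intros d. rewrite (Hup d). unfold Z.succ. reflexivity. }
  intros H. apply H0. apply (H0 n). exact H.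
Qed.

Lemma bsum_ge_term (f : nat -> R) (n k : nat) :
  (forall i, 0 <= f i) -> (k < n)%nat -> f k <= bsum f n.
Proof.
  intros Hf Hk. apply Rle_trans with (bsum f (S k)).
  - cbn [bsum]. pose proof (bsum_nonneg f k ltac:(auto)). lra.
  - apply bsum_mono; [exact Hf|lia].
Qed.

Lemma index_cases (m : Z) (N : nat) : (- Z.of_nat N <= m <= Z.of_nat N + 1)%Z ->
  exists k, (k < S N)%nat /\ (m = 0 - Z.of_nat k \/ m = 0 + 1 + Z.of_nat k)%Z.
Proof.
  intros H. destruct (Z_le_gt_dec m 0).
  - exists (Z.to_nat (- m)). split; [lia|left; lia].
  - exists (Z.to_nat (m - 1)). split; [lia|right; lia].
Qed.

(** The S N pairs cover the indices -N to N + 1, so each of the 2 N + 1 gaps considered has a pole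
    of the truncated sum at both ends. *)
Lemma finite_critical_exists (t : Z -> R) (b : R) (N : nat) (m : Z) :
  increasing t -> (- Z.of_nat N <= m <= Z.of_nat N)%Z ->
  exists s, t m < s < t (m + 1)%Z /\ b + bsum (pterm t 0 s) (S N) = 0.
Proof.
  intros Ht Hm.
  assert (HD : forall x y, t m < x < t (m + 1)%Z -> t m < y < t (m + 1)%Z ->
    bsum (pterm t 0 x) (S N) - bsum (pterm t 0 y) (S N) = bsum (fun k => (y - x) * pweight t 0 x y k) (S N)).
  { intros x y Hx Hy.
    replace (bsum (pterm t 0 x) (S N) - bsum (pterm t 0 y) (S N))
      with (bsum (pterm t 0 x) (S N) + (-1) * bsum (pterm t 0 y) (S N)) by ring.
    rewrite <- bsum_scal, <- bsum_plus. apply bsum_ext. intros k _.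
    rewrite <- (proj1 (pterm_diff t m 0 x y k Ht Hx Hy)). ring. }
  assert (Hterm : forall x y i, t m < x -> x < y -> y < t (m + 1)%Z ->
    (- Z.of_nat N <= i <= Z.of_nat N + 1)%Z ->
    (y - x) * / ((x - t i) * (y - t i)) <= bsum (pterm t 0 x) (S N) - bsum (pterm t 0 y) (S N)).
  { intros x y i H1 H2 H3 Hi.
    assert (Hx : t m < x < t (m + 1)%Z) by lra. assert (Hy : t m < y < t (m + 1)%Z) by lra.
    assert (Hnn : forall k, 0 <= (y - x) * pweight t 0 x y k).
    { intros k. destruct (pterm_diff t m 0 x y k Ht Hx Hy) as [_ [Ha Hb]].
      unfold pweight. apply Rmult_le_pos; lra. }
    rewrite HD by assumption.
    destruct (index_cases i N Hi) as [k [Hk Hik]].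
    eapply Rle_trans; [|apply (bsum_ge_term _ (S N) k Hnn Hk)].
    apply Rmult_le_compat_l; [lra|]. unfold pweight.
    destruct (pterm_diff t m 0 x y k Ht Hx Hy) as [_ [Ha Hb]].
    destruct Hik as [-> | ->]; lra. }
  destruct (monotone_root (fun x => bsum (pterm t 0 x) (S N)) (t m) (t (m + 1)%Z) (- b))
    as [s [Hs1 Hs2]].
  - apply Ht.
  - intros x y H1 H2 H3. split.
    + eapply Rle_trans; [|apply (Hterm x y m); auto; lia].
      right. field. lra.
    + eapply Rle_trans; [|apply (Hterm x y (m + 1)%Z); auto; lia].
      right. field. lra.
  - intros g Hg. exists (bsum (fun _ => 2 * / (g * g)) (S N)). intros x y Hx Hy.
    rewrite HD by lra. rewrite (bsum_scal (y - x)), Rabs_mult, Rabs_minus_sym, Rmult_comm.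
    apply Rmult_le_compat_r; [apply Rabs_pos|].
    assert (Hinv : forall i, 0 < / ((x - t i) * (y - t i)) <= / (g * g)).
    { intros i. assert (g * g <= (x - t i) * (y - t i)).
      { destruct (gap_sign t m i x Ht ltac:(lra)) as [[_ H]|[_ H]]; nra. }
      split; [apply Rinv_0_lt_compat|apply Rinv_le_contravar]; nra. }
    assert (Hw : forall k, 0 <= pweight t 0 x y k <= 2 * / (g * g)).
    { intros k. unfold pweight.
      pose proof (Hinv (0 - Z.of_nat k)%Z). pose proof (Hinv (0 + 1 + Z.of_nat k)%Z). lra. }
    rewrite Rabs_pos_eq.
    + apply bsum_le. intros k _. apply Hw.
    + apply bsum_nonneg. intros k _. apply Hw.
  - exists s. split; [exact Hs1|]. simpl in Hs2. cbn [bsum]. lra.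
Qed.

Lemma pterm_sums_strict (t : Z -> R) (x y l l' : R) (m : Z) :
  increasing t -> t m < x -> x < y -> y < t (m + 1)%Z ->
  sums_to (pterm t 0 x) l -> sums_to (pterm t 0 y) l' -> l' < l.
Proof.
  intros Ht H1 H2 H3 Hl Hl'.
  pose proof (sums_to_minus _ _ _ _ Hl Hl') as Hd.
  assert (Hpos : forall k, 0 < pterm t 0 x k - pterm t 0 y k).
  { intros k. destruct (pterm_diff t m 0 x y k Ht ltac:(lra) ltac:(lra)) as [H [Ha Hb]].
    rewrite H. unfold pweight. apply Rmult_lt_0_compat; lra. }
  pose proof (sums_to_ge_partial _ _ 1 (fun k => Rlt_le _ _ (Hpos k)) Hd) as H.
  cbn [bsum] in H. pose proof (Hpos 0%nat). lra.
Qed.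

(** The truncated sums decrease on the gap and converge pointwise. At a point left of s the limit
    exceeds -b, so eventually the truncated sum does too and its root lies further right;
    symmetrically on the other side. *)
Lemma finite_critical_lim (t : Z -> R) (A b s : R) (sN : nat -> R) (m : Z) :
  increasing t -> drift t A -> t m < s < t (m + 1)%Z -> sums_to (pterm t 0 s) (- b) ->
  (forall N, (Z.abs_nat m <= N)%nat ->
     t m < sN N < t (m + 1)%Z /\ b + bsum (pterm t 0 (sN N)) (S N) = 0) ->
  is_lim_seq sN s.
Proof.
  intros Ht HA Hs Hsum HsN.
  assert (Hmono : forall x y N, t m < x -> x <= y -> y < t (m + 1)%Z ->
    bsum (pterm t 0 y) N <= bsum (pterm t 0 x) N).
  { intros x y N H1 H2 H3. apply bsum_le. intros k _.
    destruct (pterm_diff t m 0 x y k Ht ltac:(lra) ltac:(lra)) as [H [Ha Hb]].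
    assert (0 <= (y - x) * pweight t 0 x y k); [|lra].
    unfold pweight. apply Rmult_le_pos; lra. }
  pose proof (fun x y l l' => pterm_sums_strict t x y l l' m Ht) as Hstrict.
  assert (Hex : forall x, t m < x < t (m + 1)%Z -> exists l, sums_to (pterm t 0 x) l).
  { intros x Hx. destruct (pterm_sums t A x m Ht HA Hx) as [l Hl].
    exists l. apply (pterm_recenter t A x l m 0 HA Hl). }
  assert (Hlow : forall x, t m < x < s -> eventually (fun N => x < sN N)).
  { intros x Hx. destruct (Hex x ltac:(lra)) as [l Hl].
    pose proof (Hstrict x s l (- b) ltac:(lra) ltac:(lra) ltac:(lra) Hl Hsum) as Hlt.
    apply is_lim_seq_incr_1 in Hl. apply is_lim_seq_spec in Hl.
    assert (He : 0 < l + b) by lra. destruct (Hl (mkposreal _ He)) as [N HN].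
    exists (max N (Z.abs_nat m)). intros n Hn. specialize (HN n ltac:(lia)). simpl pos in HN.
    destruct (HsN n ltac:(lia)) as [H1 H2].
    apply Rnot_le_lt. intros Hle.
    pose proof (Hmono (sN n) x (S n) ltac:(lra) Hle ltac:(lra)).
    apply Rabs_def2 in HN. lra. }
  assert (Hupp : forall x, s < x < t (m + 1)%Z -> eventually (fun N => sN N < x)).
  { intros x Hx. destruct (Hex x ltac:(lra)) as [l Hl].
    pose proof (Hstrict s x (- b) l ltac:(lra) ltac:(lra) ltac:(lra) Hsum Hl) as Hlt.
    apply is_lim_seq_incr_1 in Hl. apply is_lim_seq_spec in Hl.
    assert (He : 0 < - b - l) by lra. destruct (Hl (mkposreal _ He)) as [N HN].
    exists (max N (Z.abs_nat m)). intros n Hn. specialize (HN n ltac:(lia)). simpl pos in HN.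
    destruct (HsN n ltac:(lia)) as [H1 H2].
    apply Rnot_le_lt. intros Hle.
    pose proof (Hmono x (sN n) (S n) ltac:(lra) Hle ltac:(lra)).
    apply Rabs_def2 in HN. lra. }
  apply is_lim_seq_spec. intros eps. pose proof (cond_pos eps) as He.
  set (d := Rmin (eps / 2) (Rmin ((s - t m) / 2) ((t (m + 1)%Z - s) / 2))).
  assert (Hd : 0 < d /\ d < eps /\ d < s - t m /\ d < t (m + 1)%Z - s).
  { unfold d, Rmin. repeat destruct Rle_dec; lra. }
  destruct (Hlow (s - d) ltac:(lra)) as [N1 HN1].
  destruct (Hupp (s + d) ltac:(lra)) as [N2 HN2].
  exists (max N1 N2). intros n Hn.
  specialize (HN1 n ltac:(lia)). specialize (HN2 n ltac:(lia)).
  apply Rabs_def1; lra.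
Qed.

(** * Factorization of the finite derivatives *)

(* [ispoly n a c F]: F is a polynomial function of degree at most n + 1 whose
   coefficients in degrees n + 1 and n are a and c. *)
Inductive ispoly : nat -> R -> R -> (R -> R) -> Prop :=
| ispoly_linear (a c : R) (F : R -> R) :
    (forall x, F x = a * x + c) -> ispoly 0 a c F
| ispoly_S (n : nat) (a c d : R) (F G : R -> R) :
    ispoly n a c G -> (forall x, F x = x * G x + d) -> ispoly (S n) a c F.

Lemma ispoly_add_lower (n : nat) (a c a' c' v : R) (F G : R -> R) :
  ispoly (S n) a c F -> ispoly n a' c' G ->
  ispoly (S n) a (c + v * a') (fun x => F x + v * G x).
Proof.
  intros HF. revert a' c' G. remember (S n) as m eqn:Hm. revert n Hm.
  induction HF as [a c F HF|m a c d F F1 HF1 IH HF]; intros n Hm a' c' G HG; [discriminate|].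
  injection Hm as ->.
  inversion HG as [a1 c1 G1 HG1 E1 E2 E3 E4|n1 a1 c1 d1 G1 G2 HG2 HG1 E1 E2 E3 E4]; subst.
  - inversion HF1 as [a2 c2 G2 HF2|]; subst.
    apply ispoly_S with (d := d + v * c') (G := fun x => a * x + (c + v * a')).
    + apply ispoly_linear. reflexivity.
    + intros x. rewrite HF, HF2, HG1. ring.
  - apply ispoly_S with (d := d + v * d1) (G := fun x => F1 x + v * G2 x).
    + apply (IH n1 eq_refl a' c'). exact HG2.
    + intros x. rewrite HF, HG1. ring.
Qed.

Lemma ispoly_ext (n : nat) (a c : R) (F G : R -> R) :
  (forall x, F x = G x) -> ispoly n a c F -> ispoly n a c G.
Proof.
  intros H HF. destruct HF as [a c F HF|n a c d F F1 HF1 HF].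
  - apply ispoly_linear. intros x. rewrite <- H. apply HF.
  - apply ispoly_S with d F1; [exact HF1|]. intros x. rewrite <- H. apply HF.
Qed.

Lemma ispoly_mul (n : nat) (a c u : R) (F : R -> R) :
  ispoly n a c F -> ispoly (S n) a (c - a * u) (fun x => (x - u) * F x).
Proof.
  intros HF.
  apply ispoly_ext with (fun x => (x * F x + 0) + (- u) * F x); [intros; ring|].
  replace (c - a * u) with (c + (- u) * a) by ring.
  apply ispoly_add_lower with c; [|exact HF].
  apply ispoly_S with 0 F; auto.
Qed.

(** Horner's scheme: the recursive shape x G x + d in [ispoly] lets the division by x - u descend
    one degree at a time. *)
Lemma ispoly_div (n : nat) (a c u : R) (F : R -> R) :
  ispoly (S n) a c F ->
  exists G d, ispoly n a (c + a * u) G /\ forall x, F x = (x - u) * G x + d.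
Proof.
  remember (S n) as m eqn:Hm. intros HF. revert n Hm.
  induction HF as [a c F HF|m a c d F F1 HF1 IH HF]; intros n Hm; [discriminate|].
  injection Hm as ->. destruct n as [|n].
  - inversion HF1 as [a2 c2 G2 HF2|]; subst.
    exists (fun x => a * x + (c + a * u)), (d + u * (c + a * u)). split.
    + apply ispoly_linear. reflexivity.
    + intros x. rewrite HF, HF2. ring.
  - destruct (IH n eq_refl) as [G [d1 [HG Hd1]]].
    exists (fun x => x * G x + d1), (d + u * d1). split.
    + apply ispoly_S with d1 G; auto.
    + intros x. rewrite HF, Hd1. ring.
Qed.

Definition lsum (l : list R) : R := fold_right Rplus 0 l.
Definition lprod (x : R) (l : list R) : R := fold_right (fun u acc => (x - u) * acc) 1 l.

(** The degree exceeds the number of known zeros by at most one, so a linear cofactor remains; its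
    constant term follows from the top two coefficients, which is why [ispoly] records exactly
    these. It is not written as a multiple of x minus a root, because a will be b, which may
    vanish. *)
Lemma ispoly_factor (l : list R) (a c : R) (F : R -> R) :
  ispoly (length l) a c F -> NoDup l -> (forall u, In u l -> F u = 0) ->
  forall x, F x = (a * x + (c + a * lsum l)) * lprod x l.
Proof.
  revert c F. induction l as [|u l IH]; intros c F HF Hnd Hz x; simpl.
  - inversion HF as [a1 c1 F1 HF1|]; subst. rewrite HF1. ring.
  - destruct (ispoly_div _ _ _ u _ HF) as [G [d [HG Hd]]].
    inversion Hnd as [|u' l' Hu Hl]; subst.
    assert (Hd0 : d = 0).
    { pose proof (Hd u) as H. rewrite Hz in H by (left; reflexivity). lra. }
    subst d. rewrite Hd.
    rewrite (IH (c + a * u) G HG Hl).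
    + unfold lsum. ring.
    + intros v Hv. pose proof (Hd v) as H. rewrite Hz in H by (right; exact Hv).
      assert (v - u <> 0) by (intros E; apply Hu; replace u with v by lra; exact Hv).
      apply (Rmult_eq_reg_l (v - u)); [lra|assumption].
Qed.

(** The product rule for [bprod a] when a' holds the derivatives of the factors; being algebraic, it
    can be taken to the limit before differentiability is known. *)
Fixpoint dprod (a a' : nat -> R) (n : nat) : R :=
  match n with O => 0 | S m => dprod a a' m * a m + bprod a m * a' m end.

Definition rawfac (t : Z -> R) (x : R) (k : nat) : R :=
  (x - t (0 - Z.of_nat k)%Z) * (x - t (0 + 1 + Z.of_nat k)%Z).
Definition rawfac' (t : Z -> R) (x : R) (k : nat) : R :=
  2 * x - t (0 - Z.of_nat k)%Z - t (0 + 1 + Z.of_nat k)%Z.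
(** Normalization at x0 turns the growing quadratic factors into 1 + O(1/k^2): with p and q the
    paired zeros, the numerators at x and x0 differ by (x - x0)(x + x0 - p - q), and p + q stays
    bounded. *)
Definition pfac (t : Z -> R) (x0 x : R) (k : nat) : R := rawfac t x k / rawfac t x0 k.
Definition pfac' (t : Z -> R) (x0 x : R) (k : nat) : R := rawfac' t x k / rawfac t x0 k.

Lemma bprod_neq_0 (f : nat -> R) (n : nat) :
  (forall k, (k < n)%nat -> f k <> 0) -> bprod f n <> 0.
Proof.
  induction n as [|n IH]; intros H; simpl; [lra|].
  apply Rmult_integral_contrapositive_currified; [apply IH; intros; apply H|apply H]; lia.
Qed.

Lemma bprod_div (f g : nat -> R) (n : nat) :
  (forall k, (k < n)%nat -> g k <> 0) ->
  bprod (fun k => f k / g k) n = bprod f n / bprod g n.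
Proof.
  induction n as [|n IH]; intros H; simpl; [field|].
  rewrite IH by (intros; apply H; lia).
  field. split; [apply H; lia|apply bprod_neq_0; intros; apply H; lia].
Qed.

Lemma dprod_div (f f' g : nat -> R) (n : nat) :
  (forall k, (k < n)%nat -> g k <> 0) ->
  dprod (fun k => f k / g k) (fun k => f' k / g k) n = dprod f f' n / bprod g n.
Proof.
  induction n as [|n IH]; intros H; simpl; [field|].
  rewrite IH, bprod_div by (intros; apply H; lia).
  field. split; [apply H; lia|apply bprod_neq_0; intros; apply H; lia].
Qed.

Lemma dprod_log (t : Z -> R) (x : R) (n : nat) :
  (forall i, x <> t i) ->
  dprod (rawfac t x) (rawfac' t x) n = bprod (rawfac t x) n * bsum (pterm t 0 x) n.
Proof.
  intros H. induction n as [|n IH]; simpl; [ring|].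
  rewrite IH. unfold rawfac at 3 5, rawfac', pterm at 3. simpl.
  pose proof (H (0 - Z.of_nat n)%Z). pose proof (H (1 + Z.of_nat n)%Z). simpl in *.
  unfold rawfac. simpl. field. lra.
Qed.

Definition tsum (t : Z -> R) (n : nat) : R :=
  bsum (fun k => t (0 - Z.of_nat k)%Z + t (0 + 1 + Z.of_nat k)%Z) n.

(** Q, the raw product, is monic of degree 2 n + 2 with zero sum [tsum t (S n)]; in b Q + Q' the
    summand 2 (n + 1) of the second coefficient is the leading coefficient of Q'. The induction
    multiplies by (x - p)(x - q) and applies the product rule. *)
Lemma ispoly_rawprod (t : Z -> R) (b : R) (n : nat) :
  ispoly (2 * n + 1) 1 (- tsum t (S n)) (fun x => bprod (rawfac t x) (S n)) /\
  ispoly (2 * n + 1) b (2 * INR (S n) - b * tsum t (S n))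
    (fun x => b * bprod (rawfac t x) (S n) + dprod (rawfac t x) (rawfac' t x) (S n)).
Proof.
  induction n as [|n [IHQ IHW]].
  - set (p := t (0 - Z.of_nat 0)%Z). set (q := t (0 + 1 + Z.of_nat 0)%Z).
    split; simpl (2 * 0 + 1)%nat.
    + apply ispoly_S with (d := p * q) (G := fun x => 1 * x + (- tsum t 1)).
      * apply ispoly_linear. reflexivity.
      * intros x. unfold tsum. cbn [bprod bsum]. unfold rawfac. fold p q. ring.
    + apply ispoly_S with (d := b * (p * q) - p - q)
        (G := fun x => b * x + (2 * INR 1 - b * tsum t 1)).
      * apply ispoly_linear. reflexivity.
      * intros x. unfold tsum. cbn [bprod bsum dprod]. unfold rawfac, rawfac'. fold p q.
        simpl. ring.
  - set (p := t (0 - Z.of_nat (S n))%Z). set (q := t (0 + 1 + Z.of_nat (S n))%Z).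
    replace (2 * S n + 1)%nat with (S (S (2 * n + 1))) by lia.
    assert (HT : tsum t (S (S n)) = tsum t (S n) + (p + q)) by reflexivity.
    split.
    + apply ispoly_ext with (fun x => (x - q) * ((x - p) * bprod (rawfac t x) (S n))).
      * intros x. change (bprod (rawfac t x) (S (S n)))
          with (bprod (rawfac t x) (S n) * rawfac t x (S n)).
        unfold rawfac at 3. fold p q. ring.
      * rewrite HT. replace (- (tsum t (S n) + (p + q))) with (- tsum t (S n) - 1 * p - 1 * q) by ring.
        apply ispoly_mul, ispoly_mul, IHQ.
    + apply ispoly_ext with (fun x =>
        ((x - q) * ((x - p) * (b * bprod (rawfac t x) (S n) + dprod (rawfac t x) (rawfac' t x) (S n)))
          + 1 * ((x - p) * bprod (rawfac t x) (S n)))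
          + 1 * ((x - q) * bprod (rawfac t x) (S n))).
      * intros x. change (bprod (rawfac t x) (S (S n)))
          with (bprod (rawfac t x) (S n) * rawfac t x (S n)).
        change (dprod (rawfac t x) (rawfac' t x) (S (S n)))
          with (dprod (rawfac t x) (rawfac' t x) (S n) * rawfac t x (S n) +
                bprod (rawfac t x) (S n) * rawfac' t x (S n)).
        set (Q := bprod (rawfac t x) (S n)). set (D := dprod (rawfac t x) (rawfac' t x) (S n)).
        unfold rawfac, rawfac'. fold p q. ring.
      * rewrite HT, (S_INR (S n)).
        replace (2 * (INR (S n) + 1) - b * (tsum t (S n) + (p + q)))
          with ((2 * INR (S n) - b * tsum t (S n) - b * p - b * q) + 1 * 1 + 1 * 1) by ring.
        eapply ispoly_add_lower; [|apply ispoly_mul, IHQ].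
        eapply ispoly_add_lower; [|apply ispoly_mul, IHQ].
        apply ispoly_mul, ispoly_mul, IHW.
Qed.

(** The indices -n to n are one more than n pairs (-k, k + 1) can cover: these reach from -(n - 1)
    to n, and s (-n) remains alone. The order of the list prepares [rlist_lprod]. *)
Fixpoint rlist (s : Z -> R) (n : nat) : list R :=
  match n with
  | O => s (0 - Z.of_nat 0)%Z :: nil
  | S m => s (0 + 1 + Z.of_nat m)%Z :: s (0 - Z.of_nat (S m))%Z :: rlist s m
  end.

Lemma rlist_length (s : Z -> R) (n : nat) : length (rlist s n) = (2 * n + 1)%nat.
Proof. induction n as [|n IH]; simpl; [reflexivity|]. rewrite IH. lia. Qed.

Lemma rlist_In (s : Z -> R) (n : nat) (u : R) :
  In u (rlist s n) -> exists i, (- Z.of_nat n <= i <= Z.of_nat n)%Z /\ u = s i.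
Proof.
  induction n as [|n IH]; cbn [rlist In].
  - intros [<-|[]]. exists (0 - Z.of_nat 0)%Z. split; [lia|reflexivity].
  - intros [<-|[<-|H]].
    + exists (0 + 1 + Z.of_nat n)%Z. split; [lia|reflexivity].
    + exists (0 - Z.of_nat (S n))%Z. split; [lia|reflexivity].
    + destruct (IH H) as [i [Hi ->]]. exists i. split; [lia|reflexivity].
Qed.

Lemma rlist_NoDup (s : Z -> R) (n : nat) :
  (forall i j, (- Z.of_nat n <= i)%Z -> (i < j)%Z -> (j <= Z.of_nat n)%Z -> s i < s j) ->
  NoDup (rlist s n).
Proof.
  induction n as [|n IH]; intros Hs; cbn [rlist].
  - constructor; [intros []|constructor].
  - constructor; [|constructor].
    + intros [H|H].
      * pose proof (Hs (0 - Z.of_nat (S n))%Z (0 + 1 + Z.of_nat n)%Z ltac:(lia) ltac:(lia) ltac:(lia)). lra.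
      * destruct (rlist_In _ _ _ H) as [i [Hi E]].
        pose proof (Hs i (0 + 1 + Z.of_nat n)%Z ltac:(lia) ltac:(lia) ltac:(lia)). lra.
    + intros H. destruct (rlist_In _ _ _ H) as [i [Hi E]].
      pose proof (Hs (0 - Z.of_nat (S n))%Z i ltac:(lia) ltac:(lia) ltac:(lia)). lra.
    + apply IH. intros i j H1 H2 H3. apply Hs; lia.
Qed.

Lemma rlist_lprod (s : Z -> R) (x : R) (n : nat) :
  lprod x (rlist s n) = (x - s (0 - Z.of_nat n)%Z) * bprod (rawfac s x) n.
Proof.
  induction n as [|n IH]; [simpl; ring|].
  cbn [rlist lprod fold_right]. fold (lprod x (rlist s n)). rewrite IH.
  cbn [bprod]. unfold rawfac at 3. ring.
Qed.

(** The bounds t i <= s i <= t (i + 1), summed over i from -n to n, miss one of the 2 n + 2 terms of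
    [tsum t (S n)]: t (n + 1) on the left, t (-n) on the right. *)
Lemma rlist_lsum (s t : Z -> R) (n : nat) :
  (forall i, (- Z.of_nat n <= i <= Z.of_nat n)%Z -> t i <= s i <= t (i + 1)%Z) ->
  - t (0 + 1 + Z.of_nat n)%Z <= lsum (rlist s n) - tsum t (S n) <= - t (0 - Z.of_nat n)%Z.
Proof.
  unfold tsum. induction n as [|n IH]; intros H.
  - cbn [rlist lsum fold_right bsum].
    pose proof (H (0 - Z.of_nat 0)%Z ltac:(lia)) as H0.
    replace (0 - Z.of_nat 0 + 1)%Z with (0 + 1 + Z.of_nat 0)%Z in H0 by lia. lra.
  - specialize (IH ltac:(intros; apply H; lia)).
    cbn [rlist lsum fold_right]. fold (lsum (rlist s n)). cbn [bsum] in *.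
    pose proof (H (0 + 1 + Z.of_nat n)%Z ltac:(lia)) as H1.
    pose proof (H (0 - Z.of_nat (S n))%Z ltac:(lia)) as H2.
    replace (0 + 1 + Z.of_nat n + 1)%Z with (0 + 1 + Z.of_nat (S n))%Z in H1 by lia.
    replace (0 - Z.of_nat (S n) + 1)%Z with (0 - Z.of_nat n)%Z in H2 by lia.
    lra.
Qed.

(** * Limits of products *)

Lemma dprod_bound (a a' : nat -> R) (C : R) (n : nat) :
  0 <= C ->
  (forall k, (k < n)%nat -> Rabs (a k - 1) <= C * inv_sq k) ->
  (forall k, (k < n)%nat -> Rabs (a' k) <= C * inv_sq k) ->
  Rabs (dprod a a' n) <= exp (2 * (C * bsum inv_sq n)).
Proof.
  intros HC. induction n as [|n IH]; intros Ha Ha'; simpl.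
  - rewrite Rabs_R0. left. apply exp_pos.
  - specialize (IH ltac:(intros; apply Ha; lia) ltac:(intros; apply Ha'; lia)).
    pose proof (bprod_exp_bound a C n HC ltac:(intros; apply Ha; lia)) as Hb.
    pose proof (Ha n ltac:(lia)) as H1. pose proof (Ha' n ltac:(lia)) as H2.
    replace (2 * (C * (bsum inv_sq n + inv_sq n))) with (2 * (C * bsum inv_sq n) + 2 * (C * inv_sq n)) by ring.
    pose proof (exp_ineq1_le (2 * (C * inv_sq n))) as He.
    pose proof (sq_pos n). assert (HX : 0 <= C * bsum inv_sq n)
      by (apply Rmult_le_pos; [exact HC|apply bsum_nonneg; intros; left; apply sq_pos]).
    assert (HE : exp (C * bsum inv_sq n) <= exp (2 * (C * bsum inv_sq n))).
    { destruct (Req_dec (C * bsum inv_sq n) 0) as [->|]; [rewrite Rmult_0_r; lra|].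
      left. apply exp_increasing. lra. }
    rewrite exp_plus. set (E2 := exp (2 * (C * bsum inv_sq n))) in *.
    assert (0 < E2) by apply exp_pos.
    assert (Han : Rabs (a n) <= 1 + C * inv_sq n).
    { replace (a n) with (1 + (a n - 1)) by ring.
      eapply Rle_trans; [apply Rabs_triang|]. rewrite Rabs_R1. lra. }
    eapply Rle_trans; [apply Rabs_triang|]. rewrite !Rabs_mult.
    apply Rle_trans with (E2 * (1 + C * inv_sq n) + E2 * (C * inv_sq n)).
    + apply Rplus_le_compat; apply Rmult_le_compat; try apply Rabs_pos; lra.
    + apply Rle_trans with (E2 * (1 + 2 * (C * inv_sq n))); [right; ring|].
      apply Rmult_le_compat_l; lra.
Qed.

(** A Taylor remainder bounded uniformly in n passes to the limit and so differentiates the infinite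
    product directly. The exponent has the factor 3 because the step adds [C * inv_sq n] three times
    and 1 + 3 y <= exp (3 y). *)
Lemma bprod_second_order (a c a' : nat -> R) (C h : R) (n : nat) :
  0 <= C ->
  (forall k, (k < n)%nat -> Rabs (a k - 1) <= C * inv_sq k) ->
  (forall k, (k < n)%nat -> Rabs (c k - 1) <= C * inv_sq k) ->
  (forall k, (k < n)%nat -> Rabs (a' k) <= C * inv_sq k) ->
  (forall k, (k < n)%nat -> Rabs (c k - a k) <= C * inv_sq k * Rabs h) ->
  (forall k, (k < n)%nat -> Rabs (c k - a k - a' k * h) <= C * inv_sq k * h ^ 2) ->
  Rabs (bprod c n - bprod a n - dprod a a' n * h) <= exp (3 * (C * bsum inv_sq n)) * h ^ 2.
Proof.
  intros HC. induction n as [|n IH]; intros Ha Hc Ha' H1 H2; simpl.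
  - replace (1 - 1 - 0 * h) with 0 by ring. rewrite Rabs_R0.
    apply Rmult_le_pos; [left; apply exp_pos|nra].
  - specialize (IH ltac:(intros; apply Ha; lia) ltac:(intros; apply Hc; lia)
      ltac:(intros; apply Ha'; lia) ltac:(intros; apply H1; lia) ltac:(intros; apply H2; lia)).
    pose proof (bprod_exp_bound a C n HC ltac:(intros; apply Ha; lia)) as Hb.
    pose proof (dprod_bound a a' C n HC ltac:(intros; apply Ha; lia) ltac:(intros; apply Ha'; lia)) as Hd.
    specialize (Ha n ltac:(lia)). specialize (Hc n ltac:(lia)). specialize (Ha' n ltac:(lia)).
    specialize (H1 n ltac:(lia)). specialize (H2 n ltac:(lia)).
    replace (3 * (C * (bsum inv_sq n + inv_sq n))) with (3 * (C * bsum inv_sq n) + 3 * (C * inv_sq n)) by ring.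
    pose proof (exp_ineq1_le (3 * (C * inv_sq n))) as He.
    pose proof (sq_pos n). assert (HX : 0 <= C * bsum inv_sq n)
      by (apply Rmult_le_pos; [exact HC|apply bsum_nonneg; intros; left; apply sq_pos]).
    assert (HE : forall p, 1 <= p <= 2 -> exp (p * (C * bsum inv_sq n)) <= exp (3 * (C * bsum inv_sq n))).
    { intros p Hp. destruct (Req_dec (C * bsum inv_sq n) 0) as [->|]; [rewrite !Rmult_0_r; lra|].
      left. apply exp_increasing. nra. }
    pose proof (HE 1 ltac:(lra)) as HE1. pose proof (HE 2 ltac:(lra)) as HE2.
    rewrite Rmult_1_l in HE1.
    rewrite exp_plus. set (E3 := exp (3 * (C * bsum inv_sq n))) in *.
    assert (0 < E3) by apply exp_pos.
    assert (Hcn : Rabs (c n) <= 1 + C * inv_sq n).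
    { replace (c n) with (1 + (c n - 1)) by ring.
      eapply Rle_trans; [apply Rabs_triang|]. rewrite Rabs_R1. lra. }
    replace (bprod c n * c n - bprod a n * a n - (dprod a a' n * a n + bprod a n * a' n) * h)
      with ((bprod c n - bprod a n - dprod a a' n * h) * c n
            + bprod a n * (c n - a n - a' n * h) + dprod a a' n * h * (c n - a n)) by ring.
    assert (Hh : 0 <= h ^ 2) by nra.
    assert (Hs : 0 <= C * inv_sq n) by nra.
    change (h * (h * 1)) with (h ^ 2).
    apply Rle_trans with (E3 * h ^ 2 * (1 + C * inv_sq n) + E3 * (C * inv_sq n * h ^ 2)
                          + E3 * (C * inv_sq n * h ^ 2)).
    + eapply Rle_trans; [apply Rabs_triang|]. apply Rplus_le_compat.
      * eapply Rle_trans; [apply Rabs_triang|]. rewrite !Rabs_mult.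
        apply Rplus_le_compat; apply Rmult_le_compat; try apply Rabs_pos; try assumption; lra.
      * rewrite !Rabs_mult, Rmult_assoc. apply Rmult_le_compat; try apply Rabs_pos; [|lra|].
        { apply Rmult_le_pos; apply Rabs_pos. }
        apply Rle_trans with (Rabs h * (C * inv_sq n * Rabs h)).
        { apply Rmult_le_compat_l; [apply Rabs_pos|exact H1]. }
        rewrite <- (pow2_abs h). right. ring.
    + apply Rle_trans with (E3 * (1 + 3 * (C * inv_sq n)) * h ^ 2); [right; ring|].
      apply Rmult_le_compat_r; [exact Hh|]. apply Rmult_le_compat_l; lra.
Qed.

(* The two zeros paired in the k-th factor stay within A of -k and k + 1, and at
   distance at least g from the normalization point x0. *)
Definition pairgood (s : Z -> R) (A g x0 : R) (k : nat) : Prop :=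
  Rabs (s (0 - Z.of_nat k)%Z + INR k) <= A /\
  Rabs (s (0 + 1 + Z.of_nat k)%Z - INR k - 1) <= A /\
  g <= x0 - s (0 - Z.of_nat k)%Z /\ g <= s (0 + 1 + Z.of_nat k)%Z - x0.

(** The first square bounds the linear expressions in x, y, x0 and the paired zeros; the second
    comes from comparing k + 1 with the distances of x0 to these zeros. *)
Definition fac_const (A g r : R) : R := (2 * r + 2 * A + 2) ^ 2 * ((g + 2 * A + 2) / g) ^ 2.

Lemma pfac_bounds (s : Z -> R) (A g r x0 x y : R) (k : nat) :
  0 < g -> Rabs x0 <= A + 1 -> A + 1 <= r -> Rabs x <= r -> Rabs y <= r ->
  pairgood s A g x0 k ->
  let C := fac_const A g r in
  rawfac s x0 k <> 0 /\
  Rabs (pfac s x0 x k - 1) <= C * inv_sq k /\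
  Rabs (pfac' s x0 x k) <= C * inv_sq k /\
  Rabs (pfac s x0 y k - pfac s x0 x k) <= C * inv_sq k * Rabs (y - x) /\
  Rabs (pfac s x0 y k - pfac s x0 x k - pfac' s x0 x k * (y - x)) <= C * inv_sq k * (y - x) ^ 2.
Proof.
  intros Hg Hx0 HAr Hx Hy [Hp [Hq [Hgp Hgq]]] C.
  unfold pfac, pfac', rawfac, rawfac'.
  set (p := s (0 - Z.of_nat k)%Z) in *. set (q := s (0 + 1 + Z.of_nat k)%Z) in *.
  apply Rabs_le_between in Hp, Hq, Hx0, Hx, Hy.
  pose proof (pos_INR k).
  set (K := (g + 2 * A + 2) / g).
  assert (HA0 : 0 <= A) by lra.
  assert (HD : forall D, g <= D -> INR k - 2 * A - 1 <= D -> INR k + 1 <= K * D).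
  { intros D HD1 HD2. unfold K.
    replace ((g + 2 * A + 2) / g * D) with (D + (2 * A + 2) * (D / g)) by (field; lra).
    assert (1 <= D / g) by (apply Rle_div_r; lra). nra. }
  pose proof (HD (x0 - p) Hgp ltac:(lra)) as HP. pose proof (HD (q - x0) Hgq ltac:(lra)) as HQ.
  set (w := / ((x0 - p) * (q - x0))).
  assert (Hpos : 0 < (x0 - p) * (q - x0)) by nra.
  assert (Hw : 0 < w <= K ^ 2 * inv_sq k).
  { split; [apply Rinv_0_lt_compat, Hpos|].
    unfold w, inv_sq. apply Rmult_le_reg_l with ((x0 - p) * (q - x0)); [assumption|].
    rewrite Rinv_r by lra.
    apply Rmult_le_reg_r with ((INR k + 1) ^ 2); [nra|].
    replace ((x0 - p) * (q - x0) * (K ^ 2 * / (INR k + 1) ^ 2) * (INR k + 1) ^ 2)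
      with ((K * (x0 - p)) * (K * (q - x0))) by (field; lra).
    nra. }
  set (M := 2 * r + 2 * A + 2).
  assert (HM : 1 <= M) by (unfold M; lra).
  assert (HCw : forall z, Rabs z <= M ^ 2 -> Rabs (z * w) <= C * inv_sq k).
  { intros z Hz. rewrite Rabs_mult, (Rabs_pos_eq w) by lra.
    unfold C, fac_const. fold M K. rewrite Rmult_assoc.
    apply Rmult_le_compat; [apply Rabs_pos|lra|exact Hz|lra]. }
  assert (H1M : forall z, Rabs z <= M -> Rabs z <= M ^ 2) by (intros; nra).
  split; [|repeat split].
  - nra.
  - replace ((x - p) * (x - q) / ((x0 - p) * (x0 - q)) - 1)
      with (- (x - x0) * (x + x0 - p - q) * w) by (unfold w; field; lra).
    apply HCw. rewrite Rabs_mult. replace (M ^ 2) with (M * M) by ring.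
    apply Rmult_le_compat; try apply Rabs_pos; apply Rabs_le; unfold M; split; lra.
  - replace ((2 * x - p - q) / ((x0 - p) * (x0 - q))) with (- (2 * x - p - q) * w)
      by (unfold w; field; lra).
    apply HCw, H1M. apply Rabs_le. unfold M. split; lra.
  - replace ((y - p) * (y - q) / ((x0 - p) * (x0 - q)) - (x - p) * (x - q) / ((x0 - p) * (x0 - q)))
      with (- (y + x - p - q) * w * (y - x)) by (unfold w; field; lra).
    rewrite Rabs_mult. apply Rmult_le_compat_r; [apply Rabs_pos|].
    apply HCw, H1M. apply Rabs_le. unfold M. split; lra.
  - replace ((y - p) * (y - q) / ((x0 - p) * (x0 - q)) - (x - p) * (x - q) / ((x0 - p) * (x0 - q))
      - (2 * x - p - q) / ((x0 - p) * (x0 - q)) * (y - x))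
      with (- (1) * w * (y - x) ^ 2) by (unfold w; field; lra).
    rewrite Rabs_mult, (Rabs_pos_eq ((y - x) ^ 2)) by (apply pow2_ge_0).
    apply Rmult_le_compat_r; [apply pow2_ge_0|].
    apply HCw, H1M. apply Rabs_le. split; lra.
Qed.

Lemma fac_const_pos (A g r : R) : 0 <= fac_const A g r.
Proof. unfold fac_const. apply Rmult_le_pos; apply pow2_ge_0. Qed.

Lemma second_order_derive (H : R -> R) (x l M : R) :
  (forall y, Rabs (y - x) <= 1 -> Rabs (H y - H x - l * (y - x)) <= M * (y - x) ^ 2) ->
  is_derive H x l.
Proof.
  intros HM. apply is_derive_Reals. intros eps Heps.
  pose proof (Rabs_pos M) as HMp.
  assert (Hd : 0 < Rmin 1 (eps / (Rabs M + 1))).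
  { apply Rmin_pos; [lra|]. apply Rdiv_lt_0_compat; lra. }
  exists (mkposreal _ Hd). intros h Hh Hhd. simpl in Hhd.
  pose proof (Rmin_l 1 (eps / (Rabs M + 1))). pose proof (Rmin_r 1 (eps / (Rabs M + 1))).
  assert (Hy : Rabs (x + h - x) <= 1) by (replace (x + h - x) with h by ring; lra).
  specialize (HM (x + h) Hy). replace (x + h - x) with h in HM by ring.
  replace ((H (x + h) - H x) / h - l) with ((H (x + h) - H x - l * h) / h) by (field; exact Hh).
  unfold Rdiv. rewrite Rabs_mult, Rabs_inv.
  pose proof (Rabs_pos_lt h Hh) as Hhp.
  apply Rmult_lt_reg_r with (Rabs h); [exact Hhp|].
  rewrite Rmult_assoc, Rinv_l, Rmult_1_r by lra.
  eapply Rle_lt_trans; [exact HM|]. rewrite <- (pow2_abs h).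
  assert (Hlt : Rabs h < eps / (Rabs M + 1)) by lra.
  apply (Rmult_lt_compat_r (Rabs M + 1)) in Hlt; [|lra].
  replace (eps / (Rabs M + 1) * (Rabs M + 1)) with eps in Hlt by (field; lra).
  pose proof (Rle_abs M).
  apply Rle_lt_trans with ((Rabs h * (Rabs M + 1)) * Rabs h); [nra|].
  apply Rmult_lt_compat_r; assumption.
Qed.

Lemma pairgood_drift (t : Z -> R) (A g x0 : R) (k : nat) :
  increasing t -> drift t A -> t 0%Z + g <= x0 <= t 1%Z - g -> pairgood t A g x0 k.
Proof.
  intros Ht HA Hx.
  pose proof (HA (0 - Z.of_nat k)%Z) as H1. pose proof (HA (0 + 1 + Z.of_nat k)%Z) as H2.
  pose proof (increasing_le t (0 - Z.of_nat k) 0 Ht ltac:(lia)).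
  pose proof (increasing_le t 1 (0 + 1 + Z.of_nat k) Ht ltac:(lia)).
  rewrite minus_IZR, ?plus_IZR, <- ?INR_IZR_INZ in *.
  repeat split; try lra.
  - replace (t (0 - Z.of_nat k)%Z + INR k) with (t (0 - Z.of_nat k)%Z - (0 - INR k)) by ring. exact H1.
  - replace (t (0 + 1 + Z.of_nat k)%Z - INR k - 1)
      with (t (0 + 1 + Z.of_nat k)%Z - (0 + 1 + INR k)) by ring. exact H2.
Qed.

Lemma drift_mid (t : Z -> R) (A x : R) : drift t A -> t 0%Z < x < t 1%Z -> Rabs x <= A + 1.
Proof.
  intros HA Hx. pose proof (HA 0%Z) as H0. pose proof (HA 1%Z) as H1.
  apply (proj1 (Rabs_le_between _ _)) in H0, H1. apply Rabs_le. split; lra.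
Qed.

(* F is a nonzero multiple of exp (b x) times the symmetric product with zeros t;
   the factors are normalized to be 1 at x0. *)
Definition represents (F : R -> R) (t : Z -> R) (b : R) : Prop :=
  exists x0, t 0%Z < x0 < t 1%Z /\ F x0 <> 0 /\
    forall x, is_lim_seq (fun n => F x0 * exp (b * (x - x0)) * bprod (pfac t x0 x) n) (F x).

Lemma pfac_data (t : Z -> R) (A x0 : R) :
  increasing t -> drift t A -> t 0%Z < x0 < t 1%Z ->
  exists g, 0 < g /\ Rabs x0 <= A + 1 /\ forall k, pairgood t A g x0 k.
Proof.
  intros Ht HA Hx. destruct (gap_margin _ _ _ Hx) as [g [Hg Hxg]].
  exists g. split; [exact Hg|]. split; [apply (drift_mid t A x0 HA Hx)|].
  intros k. apply (pairgood_drift t A g x0 k Ht HA Hxg).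
Qed.

Lemma pfac_decay (t : Z -> R) (A x0 x : R) :
  increasing t -> drift t A -> t 0%Z < x0 < t 1%Z ->
  (forall k, rawfac t x0 k <> 0) /\
  exists C, 0 <= C /\ forall k, Rabs (pfac t x0 x k - 1) <= C * inv_sq k.
Proof.
  intros Ht HA Hx. destruct (pfac_data t A x0 Ht HA Hx) as [g [Hg [Hx0 Hk]]].
  assert (HB : forall k, _) by (intros k; exact (pfac_bounds t A g (Rmax (A + 1) (Rabs x)) x0 x x k
    Hg Hx0 (Rmax_l _ _) (Rmax_r _ _) (Rmax_r _ _) (Hk k))).
  split; [intros k; apply (HB k)|].
  exists (fac_const A g (Rmax (A + 1) (Rabs x))). split; [apply fac_const_pos|].
  intros k. apply (HB k).
Qed.

Lemma pfac_neq_0 (t : Z -> R) (x0 x : R) (k : nat) :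
  rawfac t x0 k <> 0 -> (forall i, x <> t i) -> pfac t x0 x k <> 0.
Proof.
  intros H0 Hx. unfold pfac, Rdiv. apply Rmult_integral_contrapositive_currified.
  - unfold rawfac. apply Rmult_integral_contrapositive_currified; apply Rminus_eq_contra, Hx.
  - apply Rinv_neq_0_compat, H0.
Qed.

Lemma mid_not_zero (t : Z -> R) (x : R) :
  increasing t -> t 0%Z < x < t 1%Z -> forall i, x <> t i.
Proof.
  intros Ht Hx i. destruct (gap_sign t 0 i x Ht Hx) as [[_ H]|[_ H]]; simpl in *; lra.
Qed.

(** Changing the normalization point divides the product at x by the product at x1, whose limit is
    nonzero because x1 is none of the t i. *)
Lemma represents_at (F : R -> R) (t : Z -> R) (A b x1 : R) :
  increasing t -> drift t A -> represents F t b -> t 0%Z < x1 < t 1%Z ->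
  F x1 <> 0 /\
  forall x, is_lim_seq (fun n => bprod (pfac t x1 x) n) (F x / (F x1 * exp (b * (x - x1)))).
Proof.
  intros Ht HA [x0 [Hx0 [HF0 HF]]] Hx1.
  destruct (pfac_decay t A x0 x1 Ht HA Hx0) as [Hr0 [C [HC Hd]]].
  destruct (pfac_decay t A x1 x1 Ht HA Hx1) as [Hr1 _].
  assert (Hlim : forall x, is_lim_seq (bprod (pfac t x0 x)) (F x / (F x0 * exp (b * (x - x0))))).
  { intros x. pose proof (exp_pos (b * (x - x0))) as He.
    apply is_lim_seq_ext with
      (fun n => / (F x0 * exp (b * (x - x0))) * (F x0 * exp (b * (x - x0)) * bprod (pfac t x0 x) n)).
    - intros n. field. split; [lra|exact HF0].
    - replace (Finite (F x / (F x0 * exp (b * (x - x0)))))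
        with (Rbar_mult (/ (F x0 * exp (b * (x - x0)))) (F x))
        by (simpl; f_equal; unfold Rdiv; apply Rmult_comm).
      apply is_lim_seq_scal_l, HF. }
  pose proof (exp_pos (b * (x1 - x0))) as He1.
  assert (HF1 : F x1 <> 0).
  { pose proof (bprod_lim_neq_0 (pfac t x0 x1) C _ HC Hd
      (fun k => pfac_neq_0 t x0 x1 k (Hr0 k) (mid_not_zero t x1 Ht Hx1)) (Hlim x1)) as H.
    intros E. apply H. rewrite E. unfold Rdiv. ring. }
  split; [exact HF1|].
  intros x. pose proof (exp_pos (b * (x - x0))) as He. pose proof (exp_pos (b * (x - x1))) as He'.
  apply is_lim_seq_ext with (fun n => bprod (pfac t x0 x) n / bprod (pfac t x0 x1) n).
  - intros n. unfold pfac. rewrite !bprod_div by auto.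
    pose proof (bprod_neq_0 (rawfac t x0) n ltac:(auto)).
    pose proof (bprod_neq_0 (rawfac t x1) n ltac:(auto)). field. auto.
  - replace (F x / (F x1 * exp (b * (x - x1))))
      with (F x / (F x0 * exp (b * (x - x0))) / (F x1 / (F x0 * exp (b * (x1 - x0))))).
    + apply is_lim_seq_div'; [apply Hlim|apply Hlim|].
      unfold Rdiv. apply Rmult_integral_contrapositive_currified; [exact HF1|].
      apply Rinv_neq_0_compat. apply Rmult_integral_contrapositive_currified; [exact HF0|lra].
    + replace (b * (x - x0)) with (b * (x - x1) + b * (x1 - x0)) by ring.
      rewrite exp_plus. field. repeat split; auto; lra.
Qed.

(** A product of nonzero factors 1 + O(1/k^2) has a nonzero limit; at t i one factor vanishes, and
    with it all later partial products. *)
Lemma represents_zero (F : R -> R) (t : Z -> R) (A b x : R) :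
  increasing t -> drift t A -> represents F t b -> (F x = 0 <-> exists i, x = t i).
Proof.
  intros Ht HA [x0 [Hx0 [HF0 HF]]].
  destruct (pfac_decay t A x0 x Ht HA Hx0) as [Hr0 [C [HC Hd]]]. split.
  - intros Hz. destruct (excluded_middle_informative (exists i, x = t i)) as [H|H]; [exact H|].
    exfalso.
    destruct (bprod_ex_lim _ C HC Hd) as [l Hl].
    assert (Hl0 : l <> 0).
    { apply (bprod_lim_neq_0 _ C l HC Hd); [|exact Hl].
      intros k. apply pfac_neq_0; [apply Hr0|]. intros i E. apply H. exists i. exact E. }
    pose proof (is_lim_seq_scal_l _ (F x0 * exp (b * (x - x0))) _ Hl) as H1.
    pose proof (is_lim_seq_unique _ _ (HF x)) as E1. rewrite (is_lim_seq_unique _ _ H1) in E1.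
    simpl in E1. injection E1 as E1. rewrite Hz in E1.
    pose proof (exp_pos (b * (x - x0))).
    apply Rmult_integral in E1. destruct E1 as [E1|E1]; [|contradiction].
    apply Rmult_integral in E1. destruct E1; [contradiction|lra].
  - intros [i ->].
    assert (Hk : exists k, pfac t x0 (t i) k = 0).
    { destruct (index_cases i (Z.abs_nat i) ltac:(lia)) as [k [_ Hik]]. exists k.
      unfold pfac, rawfac. destruct Hik as [<- | <-]; unfold Rdiv; ring. }
    destruct Hk as [k Hk].
    assert (Hb : forall n, (k < n)%nat -> bprod (pfac t x0 (t i)) n = 0).
    { induction 1 as [|n Hn IH]; cbn [bprod]; [rewrite Hk; ring|rewrite IH; ring]. }
    pose proof (is_lim_seq_unique _ _ (HF (t i))) as E1.
    assert (H0 : is_lim_seq (fun n => F x0 * exp (b * (t i - x0)) * bprod (pfac t x0 (t i)) n) 0).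
    { apply is_lim_seq_ext_loc with (fun _ => 0); [|apply is_lim_seq_const].
      exists (S k). intros n Hn. rewrite Hb by lia. ring. }
    rewrite (is_lim_seq_unique _ _ H0) in E1. injection E1 as E1. auto.
Qed.

(** * The derivative of a symmetric product *)

Lemma critical_increasing (t s : Z -> R) (b : R) :
  critical t b s -> increasing s.
Proof. intros Hc n. pose proof (proj1 (Hc n)). pose proof (proj1 (Hc (n + 1)%Z)). lra. Qed.

Lemma between_drift (t : Z -> R) (A s : R) (m : Z) :
  drift t A -> t m < s < t (m + 1)%Z -> Rabs (s - IZR m) <= A + 1.
Proof.
  intros HA Hs. pose proof (HA m) as H1. pose proof (HA (m + 1)%Z) as H2.
  rewrite plus_IZR in H2.
  apply (proj1 (Rabs_le_between _ _)) in H1, H2. apply Rabs_le. split; lra.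
Qed.

(* The left-hand side is exp (- b x) times the derivative of exp (b x) times the finite
   product. *)
Lemma finite_derivative_factor (t s : Z -> R) (b : R) (n : nat) :
  increasing t ->
  (forall m, (- Z.of_nat n <= m <= Z.of_nat n)%Z ->
     t m < s m < t (m + 1)%Z /\ b + bsum (pterm t 0 (s m)) (S n) = 0) ->
  forall x, b * bprod (rawfac t x) (S n) + dprod (rawfac t x) (rawfac' t x) (S n) =
    (b * x + (2 * INR (S n) + b * (lsum (rlist s n) - tsum t (S n)))) *
    ((x - s (0 - Z.of_nat n)%Z) * bprod (rawfac s x) n).
Proof.
  intros Ht Hs x. rewrite <- rlist_lprod.
  destruct (ispoly_rawprod t b n) as [_ HW]. rewrite <- (rlist_length s n) in HW.
  pose proof (ispoly_factor (rlist s n) _ _ _ HW) as HF. cbv beta in HF.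
  rewrite HF.
  - ring.
  - apply rlist_NoDup. intros i j H1 H2 H3.
    pose proof (proj1 (Hs i ltac:(lia))). pose proof (proj1 (Hs j ltac:(lia))).
    pose proof (increasing_le t (i + 1) j Ht ltac:(lia)). lra.
  - intros u Hu. destruct (rlist_In _ _ _ Hu) as [i [Hi ->]].
    destruct (Hs i Hi) as [H1 H2].
    rewrite dprod_log.
    + transitivity (bprod (rawfac t (s i)) (S n) * (b + bsum (pterm t 0 (s i)) (S n))); [ring|].
      rewrite H2. ring.
    + intros j. destruct (gap_sign t i j _ Ht H1) as [[_ H]|[_ H]]; lra.
Qed.

(** The expression is (u + a) / u, the ratio of a linear factor at two points: a factor whose value
    u n at the normalization point tends to infinity in modulus drops out of the product. *)
Lemma linear_ratio_lim (u : nat -> R) (a B : R) :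
  (forall n, INR n - B <= Rabs (u n)) -> is_lim_seq (fun n => 1 + a * / u n) 1.
Proof.
  intros Hu. replace (Finite 1) with (Finite (1 + a * 0)) by (f_equal; ring).
  apply is_lim_seq_plus'; [apply is_lim_seq_const|].
  apply (is_lim_seq_scal_l _ a 0). apply (inv_lim_0 u B Hu).
Qed.

Lemma pfac_lim (sN : nat -> Z -> R) (s : Z -> R) (x0 x : R) (k : nat) :
  (forall m, is_lim_seq (fun n => sN n m) (s m)) -> rawfac s x0 k <> 0 ->
  is_lim_seq (fun n => pfac (sN n) x0 x k) (pfac s x0 x k).
Proof.
  intros Hs H0. unfold pfac.
  apply is_lim_seq_div'; [| |exact H0]; unfold rawfac;
    (apply is_lim_seq_mult'; (apply is_lim_seq_minus'; [apply is_lim_seq_const|apply Hs])).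
Qed.

(** With Q the truncated product, the sequence is (b Q + Q')(x) / Q(x1), which is b +
    [bsum (pterm t 0 x1) (S n)] times the ratio of b Q + Q' at x and x1. By
    [finite_derivative_factor] this ratio consists of n pairs, handled by [bprod_tannery], and two
    linear factors, which tend to 1. *)
Lemma log_derivative_lim (t s : Z -> R) (A b x1 x l1 h : R) :
  increasing t -> drift t A -> Rabs b <= 1 / 3 -> critical t b s ->
  s 0%Z < x1 < t 1%Z -> sums_to (pterm t 0 x1) l1 ->
  is_lim_seq (bprod (pfac s x1 x)) h ->
  is_lim_seq (fun n => b * bprod (pfac t x1 x) (S n) + dprod (pfac t x1 x) (pfac' t x1 x) (S n))
    ((b + l1) * h).
Proof.
  intros Ht HA Hb Hc Hx1 Hl1 Hh.
  assert (HA0 : 0 <= A) by (eapply Rle_trans; [apply Rabs_pos|apply (HA 0%Z)]).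
  (* The roots of the n-th truncation are specified only for |m| <= n; elsewhere [epsilon] may
     return anything, so the estimates are confined to k < n. *)
  assert (HN : exists sN : nat -> Z -> R, forall n m, (- Z.of_nat n <= m <= Z.of_nat n)%Z ->
    t m < sN n m < t (m + 1)%Z /\ b + bsum (pterm t 0 (sN n m)) (S n) = 0).
  { exists (fun n m => epsilon (inhabits 0)
      (fun u => t m < u < t (m + 1)%Z /\ b + bsum (pterm t 0 u) (S n) = 0)).
    intros n m Hm. apply (epsilon_spec (inhabits 0)
      (fun u => t m < u < t (m + 1)%Z /\ b + bsum (pterm t 0 u) (S n) = 0)).
    apply finite_critical_exists; assumption. }
  destruct HN as [sN HsN].
  assert (Hlim : forall m, is_lim_seq (fun n => sN n m) (s m)).
  { intros m. destruct (Hc m) as [H1 H2].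
    apply (finite_critical_lim t A b (s m) (fun n => sN n m) m Ht HA H1).
    - apply (pterm_recenter t A _ _ m 0 HA H2).
    - intros n Hn. apply HsN. lia. }
  assert (Hs0 : t 0%Z < s 0%Z < t 1%Z) by apply (Hc 0%Z).
  assert (Hs1 : t 1%Z < s 1%Z) by apply (proj1 (Hc 1%Z)).
  pose proof (critical_increasing t s b Hc) as Hsi.
  (* Half of x1 - s 0 is kept in reserve, since the truncated root tends to s 0 and may lie to its
     right. The roots with index at least 1 lie beyond t 1. *)
  set (g := Rmin ((x1 - s 0%Z) / 2) (t 1%Z - x1)).
  pose proof (Rmin_l ((x1 - s 0%Z) / 2) (t 1%Z - x1)) as Hg1.
  pose proof (Rmin_r ((x1 - s 0%Z) / 2) (t 1%Z - x1)) as Hg2. fold g in Hg1, Hg2.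
  assert (Hg : 0 < g) by (apply Rmin_pos; lra).
  assert (Hdr : drift s (A + 1)) by (intros m; apply (between_drift t A (s m) m HA), (Hc m)).
  assert (Hx1A : Rabs x1 <= A + 1) by (apply (drift_mid t A x1 HA); lra).
  assert (Hev : eventually (fun n => sN n 0%Z < s 0%Z + g)).
  { pose proof (Hlim 0%Z) as H. apply is_lim_seq_spec in H.
    destruct (H (mkposreal g Hg)) as [N HN]. exists N. intros n Hn.
    specialize (HN n Hn). simpl in HN. apply Rabs_def2 in HN. lra. }
  destruct Hev as [N0 HN0].
  assert (Hgood : forall n k, (N0 <= n)%nat -> (k < n)%nat -> pairgood (sN n) (A + 1) g x1 k).
  { intros n k Hn Hk.
    destruct (HsN n (0 - Z.of_nat k)%Z ltac:(lia)) as [H1 _].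
    destruct (HsN n (0 + 1 + Z.of_nat k)%Z ltac:(lia)) as [H2 _].
    pose proof (between_drift t A _ _ HA H1) as H3. pose proof (between_drift t A _ _ HA H2) as H4.
    rewrite minus_IZR, ?plus_IZR, <- ?INR_IZR_INZ in *.
    repeat split.
    - replace (sN n (0 - Z.of_nat k)%Z + INR k) with (sN n (0 - Z.of_nat k)%Z - (0 - INR k)) by ring.
      exact H3.
    - replace (sN n (0 + 1 + Z.of_nat k)%Z - INR k - 1)
        with (sN n (0 + 1 + Z.of_nat k)%Z - (0 + 1 + INR k)) by ring. exact H4.
    - destruct k as [|k].
      + specialize (HN0 n Hn). simpl. lra.
      + pose proof (increasing_le t (0 - Z.of_nat (S k) + 1) 0 Ht ltac:(lia)). lra.
    - pose proof (increasing_le t 1 (0 + 1 + Z.of_nat k) Ht ltac:(lia)). lra. }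
  assert (Hgoods : forall k, pairgood s (A + 1) g x1 k).
  { intros k. apply pairgood_drift; auto. split; lra. }
  set (r := Rmax (A + 1 + 1) (Rabs x)).
  assert (HBn : forall n k, (N0 <= n)%nat -> (k < n)%nat -> _) by
    (intros n k Hn Hk; exact (pfac_bounds (sN n) (A + 1) g r x1 x x k Hg
      ltac:(lra) (Rmax_l _ _) (Rmax_r _ _) (Rmax_r _ _) (Hgood n k Hn Hk))).
  assert (HBs : forall k, _) by (intros k; exact (pfac_bounds s (A + 1) g r x1 x x k Hg
      ltac:(lra) (Rmax_l _ _) (Rmax_r _ _) (Rmax_r _ _) (Hgoods k))).
  cbv zeta in HBn, HBs.
  assert (Hprod : is_lim_seq (fun n => bprod (pfac (sN n) x1 x) n) h).
  { apply is_lim_seq_ext with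
      (fun n => (bprod (pfac (sN n) x1 x) n - bprod (pfac s x1 x) n) + bprod (pfac s x1 x) n);
      [intros; ring|].
    replace h with (0 + h) by ring. apply is_lim_seq_plus'; [|exact Hh].
    apply (bprod_tannery (fun n => pfac (sN n) x1 x) (pfac s x1 x) (fac_const (A + 1) g r) N0).
    - apply fac_const_pos.
    - intros n k Hn Hk. apply (HBn n k Hn Hk).
    - intros k. apply (HBs k).
    - intros k. apply pfac_lim; [exact Hlim|apply (HBs k)]. }
  (* This is the constant term of the extra linear factor. By [rlist_lsum] the difference multiplied
     by b is at most n + 1 + A in modulus, so |b| <= 1/3 leaves at least 5 (n + 1) / 3 - A / 3. *)
  set (Bn := fun n => 2 * INR (S n) + b * (lsum (rlist (sN n) n) - tsum t (S n))).
  apply (proj1 (Rabs_le_between _ _)) in Hb. apply (proj1 (Rabs_le_between _ _)) in Hx1A.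
  assert (HB : forall n, INR n - (2 * A + 1) <= b * x1 + Bn n).
  { intros n. unfold Bn. rewrite S_INR. pose proof (pos_INR n).
    pose proof (rlist_lsum (sN n) t n) as H1.
    assert (H2 : forall i, (- Z.of_nat n <= i <= Z.of_nat n)%Z -> t i <= sN n i <= t (i + 1)%Z).
    { intros i Hi. destruct (HsN n i Hi) as [H2 _]. lra. }
    specialize (H1 H2). clear H2.
    pose proof (HA (0 + 1 + Z.of_nat n)%Z) as H2. pose proof (HA (0 - Z.of_nat n)%Z) as H3.
    rewrite minus_IZR, ?plus_IZR, <- ?INR_IZR_INZ in *.
    apply (proj1 (Rabs_le_between _ _)) in H2, H3.
    set (D := lsum (rlist (sN n) n) - tsum t (S n)) in *.
    assert (HD : - (INR n + 1 + A) <= D <= INR n + 1 + A) by lra.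
    assert (- (1 / 3) * (INR n + 1 + A) <= b * D) by nra.
    assert (- (1 / 3) * (A + 1) <= b * x1) by nra. lra. }
  assert (Hsig : forall n, INR n - (2 * A + 2) <= x1 - sN n (0 - Z.of_nat n)%Z).
  { intros n. destruct (HsN n (0 - Z.of_nat n)%Z ltac:(lia)) as [H1 _].
    pose proof (between_drift t A _ _ HA H1) as H3.
    rewrite minus_IZR, <- ?INR_IZR_INZ in H3.
    apply (proj1 (Rabs_le_between _ _)) in H3. lra. }
  destruct (nfloor_ex (2 * A + 2)) as [N1 [_ HN1]]; [lra|].
  apply is_lim_seq_ext_loc with (fun n =>
    (b + bsum (pterm t 0 x1) (S n)) *
    ((1 + b * (x - x1) * / (b * x1 + Bn n)) * (1 + (x - x1) * / (x1 - sN n (0 - Z.of_nat n)%Z)))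
    * bprod (pfac (sN n) x1 x) n).
  - exists (max N0 (S N1)). intros n Hn.
    assert (HnN : INR N1 + 1 <= INR n) by (rewrite <- S_INR; apply le_INR; lia).
    specialize (HB n). specialize (Hsig n).
    assert (Hnz : forall i, x1 <> t i) by (apply mid_not_zero; auto; lra).
    assert (Hrt : forall k, rawfac t x1 k <> 0).
    { intros k. unfold rawfac. apply Rmult_integral_contrapositive_currified;
        apply Rminus_eq_contra, Hnz. }
    assert (Hrs : forall k, (k < n)%nat -> rawfac (sN n) x1 k <> 0)
      by (intros k Hk; apply (HBn n k ltac:(lia) Hk)).
    unfold pfac at 2 3, pfac'. rewrite bprod_div, dprod_div by auto.
    unfold pfac. rewrite bprod_div by exact Hrs.
    pose proof (finite_derivative_factor t (sN n) b n Ht (HsN n)) as HW.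
    pose proof (HW x) as HWx. pose proof (HW x1) as HW1.
    rewrite dprod_log in HW1 by exact Hnz.
    fold (Bn n) in HWx, HW1.
    assert (HQ : bprod (rawfac t x1) (S n) <> 0) by (apply bprod_neq_0; auto).
    assert (HP : bprod (rawfac (sN n) x1) n <> 0) by (apply bprod_neq_0; auto).
    set (Q := bprod (rawfac t x1) (S n)) in *.
    set (P := bprod (rawfac (sN n) x1) n) in *.
    set (sg := sN n (0 - Z.of_nat n)%Z) in *.
    set (S1 := bsum (pterm t 0 x1) (S n)) in *.
    replace (b * (bprod (rawfac t x) (S n) / Q) + dprod (rawfac t x) (rawfac' t x) (S n) / Q)
      with ((b * bprod (rawfac t x) (S n) + dprod (rawfac t x) (rawfac' t x) (S n)) / Q)
      by (field; exact HQ).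
    rewrite HWx.
    assert (HS1 : b + S1 = (b * x1 + Bn n) * ((x1 - sg) * P) / Q).
    { rewrite <- HW1. field. exact HQ. }
    rewrite HS1. field. repeat split; auto; lra.
  - replace ((b + l1) * h) with ((b + l1) * (1 * 1) * h) by ring.
    apply is_lim_seq_mult'; [|exact Hprod].
    apply is_lim_seq_mult'.
    + apply is_lim_seq_plus'; [apply is_lim_seq_const|].
      apply (is_lim_seq_incr_1 (bsum (pterm t 0 x1))), Hl1.
    + apply is_lim_seq_mult'.
      * apply (linear_ratio_lim _ _ (2 * A + 1)). intros n.
        eapply Rle_trans; [apply HB|apply Rle_abs].
      * apply (linear_ratio_lim _ _ (2 * A + 2)). intros n.
        eapply Rle_trans; [apply Hsig|apply Rle_abs].
Qed.

(** Write H for F freed of its constant and exponential, and Hs for the product over s. In the limit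
    b H + H' = (b + l1) Hs; multiplied by the exponential this is the product form of F', with the
    same b. *)
Lemma represents_step (F : R -> R) (t s : Z -> R) (A b : R) :
  increasing t -> drift t A -> Rabs b <= 1 / 3 -> critical t b s -> represents F t b ->
  exists F', (forall x, is_derive F x (F' x)) /\ represents F' s b.
Proof.
  intros Ht HA Hb Hc HF.
  assert (Hs0 : t 0%Z < s 0%Z < t 1%Z) by apply (Hc 0%Z).
  assert (Hs1 : t 1%Z < s 1%Z) by apply (proj1 (Hc 1%Z)).
  pose proof (critical_increasing t s b Hc) as Hsi.
  assert (Hdr : drift s (A + 1)) by (intros m; apply (between_drift t A (s m) m HA), (Hc m)).
  (* This point lies in both (t 0, t 1) and (s 0, s 1), so it normalizes both products. Being to the
     right of s 0, it also makes b + l1 negative, hence F' nonzero there. *)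
  set (x1 := (s 0%Z + t 1%Z) / 2).
  assert (Hx1 : s 0%Z < x1 < t 1%Z) by (unfold x1; lra).
  destruct (represents_at F t A b x1 Ht HA HF ltac:(lra)) as [HF1 HFl].
  set (H := fun x => F x / (F x1 * exp (b * (x - x1)))) in *.
  destruct (pterm_sums t A x1 0 Ht HA ltac:(simpl; lra)) as [l1 Hl1].
  assert (Hkap : b + l1 <> 0).
  { assert (l1 < - b); [|lra].
    apply (pterm_sums_strict t (s 0%Z) x1 (- b) l1 0 Ht); simpl; try lra; [apply (Hc 0%Z)|exact Hl1]. }
  set (Hs := fun x => real (Lim_seq (bprod (pfac s x1 x)))).
  assert (HHs : forall x, is_lim_seq (bprod (pfac s x1 x)) (Hs x)).
  { intros x. destruct (pfac_decay s (A + 1) x1 x Hsi Hdr ltac:(lra)) as [_ [C [HC Hd]]].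
    destruct (bprod_ex_lim _ C HC Hd) as [l Hl].
    unfold Hs. rewrite (is_lim_seq_unique _ _ Hl). exact Hl. }
  assert (HD : forall x, is_lim_seq (fun n => dprod (pfac t x1 x) (pfac' t x1 x) (S n))
                 ((b + l1) * Hs x - b * H x)).
  { intros x.
    apply is_lim_seq_ext with (fun n =>
      (b * bprod (pfac t x1 x) (S n) + dprod (pfac t x1 x) (pfac' t x1 x) (S n))
      - b * bprod (pfac t x1 x) (S n)); [intros; ring|].
    apply is_lim_seq_minus'.
    - apply (log_derivative_lim t s A b x1 x l1 (Hs x)); auto.
    - apply (is_lim_seq_scal_l _ b (H x)).
      apply (is_lim_seq_incr_1 (bprod (pfac t x1 x))), HFl. }
  assert (HdH : forall x, is_derive H x ((b + l1) * Hs x - b * H x)).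
  { intros x.
    destruct (pfac_data t A x1 Ht HA ltac:(lra)) as [g [Hg [HxA Hgood]]].
    set (r := Rmax (A + 1) (Rabs x + 1)).
    pose proof (Rmax_l (A + 1) (Rabs x + 1)) as Hr1. pose proof (Rmax_r (A + 1) (Rabs x + 1)) as Hr2.
    fold r in Hr1, Hr2.
    apply second_order_derive with (exp (3 * (2 * fac_const A g r))). intros y Hy.
    assert (Hyr : Rabs y <= r).
    { replace y with (x + (y - x)) by ring. eapply Rle_trans; [apply Rabs_triang|lra]. }
    assert (HB : forall k, _) by (intros k; exact (pfac_bounds t A g r x1 x y k Hg
      HxA Hr1 ltac:(lra) Hyr (Hgood k))).
    assert (HBy : forall k, _) by (intros k; exact (pfac_bounds t A g r x1 y y k Hg
      HxA Hr1 Hyr Hyr (Hgood k))).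
    cbv zeta in HB, HBy.
    pose proof (fac_const_pos A g r) as HC.
    apply (is_lim_seq_le
      (fun n => Rabs (bprod (pfac t x1 y) (S n) - bprod (pfac t x1 x) (S n)
                 - dprod (pfac t x1 x) (pfac' t x1 x) (S n) * (y - x)))
      (fun _ => exp (3 * (2 * fac_const A g r)) * (y - x) ^ 2)
      (Rabs (H y - H x - ((b + l1) * Hs x - b * H x) * (y - x)))
      (exp (3 * (2 * fac_const A g r)) * (y - x) ^ 2)).
    - intros n.
      eapply Rle_trans; [apply (bprod_second_order _ _ _ (fac_const A g r)); auto; intros k _|].
      + apply (HB k).
      + apply (HBy k).
      + apply (HB k).
      + apply (HB k).
      + apply (HB k).
      + apply Rmult_le_compat_r; [apply pow2_ge_0|].
        pose proof (bsum_sq_le (S n)) as Hsq.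
        assert (Hle : 3 * (fac_const A g r * bsum inv_sq (S n)) <= 3 * (2 * fac_const A g r)) by nra.
        destruct Hle as [Hlt|Heq]; [left; apply exp_increasing, Hlt|rewrite Heq; lra].
    - apply (is_lim_seq_abs _ (H y - H x - ((b + l1) * Hs x - b * H x) * (y - x))).
      apply is_lim_seq_minus'; [apply is_lim_seq_minus'|].
      + apply (is_lim_seq_incr_1 (bprod (pfac t x1 y))), HFl.
      + apply (is_lim_seq_incr_1 (bprod (pfac t x1 x))), HFl.
      + apply is_lim_seq_mult'; [apply HD|apply is_lim_seq_const].
    - apply is_lim_seq_const. }
  set (F' := fun x => F x1 * (b + l1) * exp (b * (x - x1)) * Hs x).
  exists F'. split.
  - intros x.
    apply is_derive_ext with (fun x => F x1 * exp (b * (x - x1)) * H x).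
    { intros y. unfold H. pose proof (exp_pos (b * (y - x1))).
      match goal with |- ?u = ?v => change (@eq R u v) end. field. split; [lra|exact HF1]. }
    assert (He : is_derive (fun x => F x1 * exp (b * (x - x1))) x (F x1 * (b * exp (b * (x - x1))))).
    { auto_derive; [auto|]. unfold Rminus. ring. }
    pose proof (is_derive_mult _ _ x _ _ He (HdH x) Rmult_comm) as Hm.
    replace (F' x) with (plus (mult (F x1 * (b * exp (b * (x - x1)))) (H x))
      (mult (F x1 * exp (b * (x - x1))) ((b + l1) * Hs x - b * H x))); [exact Hm|].
    unfold plus, mult, F'. simpl.
    match goal with |- ?u = ?v => change (@eq R u v) end. ring.
  - assert (Hs1x : Hs x1 = 1).
    { destruct (pfac_decay s (A + 1) x1 x1 Hsi Hdr ltac:(lra)) as [Hr _].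
      unfold Hs. rewrite (Lim_seq_ext _ (fun _ => 1)); [rewrite Lim_seq_const; reflexivity|].
      intros n. unfold pfac. rewrite bprod_div by auto. unfold Rdiv. apply Rinv_r.
      apply bprod_neq_0; auto. }
    assert (HF'1 : F' x1 = F x1 * (b + l1)).
    { unfold F'. rewrite Hs1x, Rminus_diag, Rmult_0_r, exp_0. ring. }
    exists x1. split; [lra|]. split.
    + rewrite HF'1. apply Rmult_integral_contrapositive_currified; assumption.
    + intros x. rewrite HF'1. unfold F'. apply (is_lim_seq_scal_l _ _ (Hs x)), HHs.
Qed.

(** * Derivatives of the canonical product and their zeros *)

Lemma critical_exists (t : Z -> R) (A b : R) :
  increasing t -> drift t A -> exists s, critical t b s.
Proof.
  intros Ht HA.
  exists (fun n => epsilon (inhabits 0) (fun u => t n < u < t (n + 1)%Z /\ sums_to (pterm t n u) (- b))).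
  intros n. apply (epsilon_spec (inhabits 0)
    (fun u => t n < u < t (n + 1)%Z /\ sums_to (pterm t n u) (- b))).
  apply (critical_exists_at t A b n Ht HA).
Qed.

(* [C_lim] approaches its point along the horizontal direction only. *)
Lemma C_derive_RtoC (f : C -> C) (F : R -> R) (x l : R) :
  (forall y, f (RtoC y) = RtoC (F y)) -> is_derive F x l -> C_derive f (RtoC x) = RtoC l.
Proof.
  intros Hf HF. apply is_derive_Reals in HF.
  assert (Hq : forall y, y <> x ->
    ((f (y, 0) - f (RtoC x)) / ((y, 0) - RtoC x))%C = RtoC ((F y - F x) / (y - x))).
  { intros y Hy. change (y, 0) with (RtoC y). rewrite !Hf, RtoC_div, !RtoC_minus; [reflexivity|lra]. }
  unfold C_derive, C_lim. simpl fst; simpl snd. unfold RtoC at 5. f_equal.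
  - assert (H : is_lim (fun y => fst ((f (y, 0) - f (RtoC x)) / ((y, 0) - RtoC x))%C) x l).
    { apply is_lim_spec. intros eps. destruct (HF eps (cond_pos eps)) as [d Hd].
      exists d. intros y Hy Hne. rewrite Hq by exact Hne. simpl fst.
      change R in (type of y). specialize (Hd (y - x)).
      replace (x + (y - x)) with y in Hd by (simpl; lra).
      apply Hd; [apply Rminus_eq_contra, Hne|exact Hy]. }
    exact (f_equal real (is_lim_unique _ _ _ H)).
  - assert (H : is_lim (fun y => snd ((f (y, 0) - f (RtoC x)) / ((y, 0) - RtoC x))%C) x 0).
    { apply is_lim_spec. intros eps. exists (mkposreal 1 Rlt_0_1).
      intros y Hy Hne. rewrite Hq by exact Hne. simpl snd.
      rewrite Rminus_diag, Rabs_R0. apply cond_pos. }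
    exact (f_equal real (is_lim_unique _ _ _ H)).
Qed.

Lemma osc_drift (t : Z -> R) (e : R) : osc t e -> drift t (e + Rabs (t 0%Z)).
Proof.
  intros Ho m. pose proof (Ho 0%Z m) as H. rewrite Z.add_0_l in H.
  replace (t m - IZR m) with ((t m - t 0%Z - IZR m) + t 0%Z) by ring.
  eapply Rle_trans; [apply Rabs_triang|lra].
Qed.

Lemma derivative_step (g : C -> C) (F : R -> R) (t : Z -> R) (b e : R) :
  osc t e -> e <= 1 / 10 -> Rabs b <= 1 / 3 ->
  (forall x, g (RtoC x) = RtoC (F x)) -> represents F t b ->
  exists s F', critical t b s /\
    (forall x, C_derive g (RtoC x) = RtoC (F' x)) /\ represents F' s b.
Proof.
  intros Ho He Hb Hg HF.
  pose proof (osc_increasing t e Ho He) as Ht. pose proof (osc_drift t e Ho) as HA.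
  destruct (critical_exists t _ b Ht HA) as [s Hs].
  destruct (represents_step F t s _ b Ht HA Hb Hs HF) as [F' [Hd HF']].
  exists s, F'. split; [exact Hs|]. split; [|exact HF'].
  intros x. apply (C_derive_RtoC g F); auto.
Qed.

(** The hypotheses of [derivative_step] are restored at each stage: [gap_decay] returns the same e
    for T j, and b never changes. *)
Lemma derivative_tower (f : C -> C) (F : R -> R) (t : Z -> R) (b e : R) (j : nat) :
  osc t e -> 0 < e <= 1 / 10 -> Rabs b <= 1 / 3 ->
  (forall x, f (RtoC x) = RtoC (F x)) -> represents F t b ->
  exists T : nat -> Z -> R, T O = t /\
    (forall i, (i < j)%nat -> critical (T i) b (T (S i))) /\
    exists G, (forall x, C_derive_n f j (RtoC x) = RtoC (G x)) /\ represents G (T j) b.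
Proof.
  intros Ho He Hb Hf HF. induction j as [|j [T [HT0 [HT [G [HG HGr]]]]]].
  - exists (fun _ => t). split; [reflexivity|]. split; [lia|]. exists F. split; assumption.
  - assert (Hoj : osc (T j) e).
    { apply (gap_decay T b e j); auto; [lra|]. rewrite HT0. exact Ho. }
    destruct (derivative_step (C_derive_n f j) G (T j) b e) as [s [G' [Hs [HG' HGr']]]]; auto; [lra|].
    exists (fun i => if Nat.leb i j then T i else s). split; [exact HT0|]. split.
    + intros i Hi. rewrite (proj2 (Nat.leb_le i j)) by lia.
      destruct (Nat.leb_spec (S i) j) as [H|H]; [apply HT; lia|].
      replace i with j by lia. exact Hs.
    + rewrite (proj2 (Nat.leb_gt (S j) j)) by lia. exists G'. split; [exact HG'|exact HGr'].
Qed.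

(** Order 0 in [lists_zeros] forces every z n to be a zero; order 1 makes every t k occur exactly
    once, t k being simple because the zeros of the derivative lie strictly inside the gaps. Hence z
    is strictly increasing with values exactly the t k, and neighbours correspond to neighbours. *)
Lemma lists_zeros_gap (g : C -> C) (F F' : R -> R) (t s : Z -> R) (A b : R) (z : Z -> R) :
  increasing t -> drift t A -> critical t b s ->
  (forall x, g (RtoC x) = RtoC (F x)) -> represents F t b ->
  (forall x, C_derive g (RtoC x) = RtoC (F' x)) -> represents F' s b ->
  lists_zeros g z -> forall n, exists k, z n = t k /\ z (n + 1)%Z = t (k + 1)%Z.
Proof.
  intros Ht HA Hc Hg HF Hg' HF' [Hmono Hz].
  assert (Hdr : drift s (A + 1)) by (intros m; apply (between_drift t A (s m) m HA), (Hc m)).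
  pose proof (critical_increasing t s b Hc) as Hsi.
  assert (Hin : forall n, exists k, z n = t k).
  { intros n. apply (represents_zero F t A b (z n) Ht HA HF).
    destruct (Req_dec (F (z n)) 0) as [E|E]; [exact E|]. exfalso.
    destruct (Hz (RtoC (z n)) O) as [l [_ [Hl Hn]]].
    - split; [lia|]. simpl. rewrite Hg. intros H. apply E, RtoC_inj, H.
    - destruct l; [|discriminate]. destruct (proj2 (Hn n) eq_refl). }
  assert (Huniq : forall k, exists m, forall n, z n = t k <-> n = m).
  { intros k. destruct (Hz (RtoC (t k)) 1%nat) as [l [_ [Hl Hn]]].
    - split.
      + intros i Hi. replace i with O by lia. simpl. rewrite Hg. f_equal.
        apply (represents_zero F t A b (t k) Ht HA HF). exists k. reflexivity.
      + simpl. rewrite Hg'. intros H. apply RtoC_inj in H.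
        apply (represents_zero F' s (A + 1) b (t k) Hsi Hdr HF') in H. destruct H as [i Hi].
        pose proof (proj1 (Hc i)) as Hci.
        destruct (gap_sign t i k (s i) Ht Hci) as [[_ H]|[_ H]]; lra.
    - destruct l as [|m [|m' l]]; try discriminate. exists m. intros n. split.
      + intros E. assert (H : In n (m :: nil)) by (apply Hn; rewrite E; reflexivity).
        destruct H as [H|[]]. auto.
      + intros ->. apply RtoC_inj, Hn. left. reflexivity. }
  assert (Hmono' : increasing z).
  { intros n. destruct (Rle_lt_or_eq_dec _ _ (Hmono n)) as [H|H]; [exact H|]. exfalso.
    destruct (Hin n) as [k Hk]. destruct (Huniq k) as [m Hm].
    pose proof (proj1 (Hm n) Hk). pose proof (proj1 (Hm (n + 1)%Z) ltac:(lra)). lia. }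
  intros n. destruct (Hin n) as [k Hk]. destruct (Hin (n + 1)%Z) as [k' Hk'].
  pose proof (Hmono' n) as Hlt.
  assert (Hkk : (k < k')%Z).
  { destruct (Z_lt_le_dec k k') as [H|H]; [exact H|].
    pose proof (increasing_le t k' k Ht H). lra. }
  exists k. split; [exact Hk|].
  destruct (Huniq (k + 1)%Z) as [m Hm]. pose proof (proj2 (Hm m) eq_refl) as Hzm.
  assert (Hnm : (n < m)%Z).
  { destruct (Z_lt_le_dec n m) as [H|H]; [exact H|].
    pose proof (increasing_le z m n Hmono' H). pose proof (Ht k). lra. }
  assert (Hmn : (m <= n + 1)%Z).
  { destruct (Z_le_gt_dec m (n + 1)) as [H|H]; [exact H|].
    pose proof (increasing_lt z (n + 1) m Hmono' ltac:(lia)).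
    pose proof (increasing_le t (k + 1) k' Ht ltac:(lia)). lra. }
  replace (n + 1)%Z with m by lia. exact Hzm.
Qed.

(** * The canonical product on the real line *)

Definition lfac (t : Z -> R) (x : R) (k : nat) : R :=
  (1 - x / t (0 + 1 + Z.of_nat k)%Z) * (1 - x / t (0 - Z.of_nat (S k))%Z).

Definition lrec (t : Z -> R) (k : nat) : R :=
  / t (0 + 1 + Z.of_nat k)%Z + / t (0 - Z.of_nat (S k))%Z.

(** 1/p + 1/q = (p + q) / (p q), where |p + q| <= 2 d and p q is about -(k + 1)^2: the cancellation
    within the pair supplies both the factor d and the decay. *)
Lemma drift_inv (t : Z -> R) (d : R) (k : nat) : drift t d -> d <= 1 / 10 ->
  9 / 10 * (INR k + 1) <= t (0 + 1 + Z.of_nat k)%Z /\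
  t (0 - Z.of_nat (S k))%Z <= - (9 / 10 * (INR k + 1)) /\
  0 < - / (t (0 + 1 + Z.of_nat k)%Z * t (0 - Z.of_nat (S k))%Z) <= 2 * inv_sq k /\
  Rabs (lrec t k) <= 4 * d * inv_sq k.
Proof.
  intros Hd Hd1. pose proof (pos_INR k).
  pose proof (Hd (0 + 1 + Z.of_nat k)%Z) as H1. pose proof (Hd (0 - Z.of_nat (S k))%Z) as H2.
  rewrite minus_IZR, ?plus_IZR, <- ?INR_IZR_INZ, S_INR in *.
  apply (proj1 (Rabs_le_between _ _)) in H1, H2. unfold lrec.
  set (p := t (0 + 1 + Z.of_nat k)%Z) in *. set (q := t (0 - Z.of_nat (S k))%Z) in *.
  assert (Hpq : 1 / 2 * (INR k + 1) ^ 2 <= p * - q) by nra.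
  assert (Hw : 0 < - / (p * q) <= 2 * inv_sq k).
  { replace (- / (p * q)) with (/ (p * - q)) by (field; lra).
    replace (2 * inv_sq k) with (/ (1 / 2 * (INR k + 1) ^ 2)) by (unfold inv_sq; field; lra).
    split; [apply Rinv_0_lt_compat|apply Rinv_le_contravar]; nra. }
  repeat split; try lra.
  replace (/ p + / q) with (- (p + q) * (- / (p * q))) by (field; lra).
  rewrite Rabs_mult, (Rabs_pos_eq (- / (p * q))) by lra.
  replace (4 * d * inv_sq k) with (2 * d * (2 * inv_sq k)) by ring.
  apply Rmult_le_compat; [apply Rabs_pos|lra| |lra].
  apply Rabs_le. split; lra.
Qed.

Lemma lfac_decay (t : Z -> R) (d x : R) (k : nat) : drift t d -> d <= 1 / 10 ->
  Rabs (lfac t x k - 1) <= (Rabs x + 2 * x ^ 2) * inv_sq k.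
Proof.
  intros Hd Hd1. destruct (drift_inv t d k Hd Hd1) as [H1 [H2 [H3 H4]]].
  pose proof (pos_INR k). pose proof (sq_pos k).
  unfold lfac, lrec in *.
  set (p := t (0 + 1 + Z.of_nat k)%Z) in *. set (q := t (0 - Z.of_nat (S k))%Z) in *.
  replace ((1 - x / p) * (1 - x / q) - 1)
    with (- x * (/ p + / q) + - (x ^ 2 * (- / (p * q)))) by (field; lra).
  eapply Rle_trans; [apply Rabs_triang|].
  rewrite Rabs_Ropp, !Rabs_mult, Rabs_Ropp, (Rabs_pos_eq (x ^ 2)), (Rabs_pos_eq (- / (p * q)))
    by (try apply pow2_ge_0; lra).
  assert (Rabs x * Rabs (/ p + / q) <= Rabs x * inv_sq k).
  { apply Rmult_le_compat_l; [apply Rabs_pos|]. nra. }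
  assert (x ^ 2 * - / (p * q) <= x ^ 2 * (2 * inv_sq k)).
  { apply Rmult_le_compat_l; [apply pow2_ge_0|lra]. }
  lra.
Qed.

(** The canonical product pairs k + 1 with -(k + 1), [rawfac] pairs k + 1 with -k. The S n raw pairs
    cover -n to n + 1: the index 0, n canonical pairs, and n + 1, whose factor tends to 1 after
    normalization. *)
Lemma rawprod_lfac (t : Z -> R) (x : R) (n : nat) :
  (forall k, t (0 + 1 + Z.of_nat k)%Z <> 0) -> (forall k, t (0 - Z.of_nat (S k))%Z <> 0) ->
  bprod (rawfac t x) (S n) = (x - t 0%Z) * bprod (lfac t x) n *
    bprod (fun k => t (0 + 1 + Z.of_nat k)%Z * t (0 - Z.of_nat (S k))%Z) n *
    (x - t (0 + 1 + Z.of_nat n)%Z).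
Proof.
  intros Hp Hq. induction n as [|n IH].
  - simpl. unfold rawfac. simpl. ring.
  - change (bprod (rawfac t x) (S (S n))) with (bprod (rawfac t x) (S n) * rawfac t x (S n)).
    rewrite IH. cbn [bprod]. set (L := bprod (lfac t x) n).
    set (B := bprod _ n). unfold rawfac, lfac.
    field. split; [apply Hq|apply Hp].
Qed.

Definition real_product (c : R) (t : Z -> R) (x : R) : R :=
  c * (x - t 0%Z) * real (Lim_seq (fun n => bprod (lfac t x) n * exp (x * bsum (lrec t) n))).

Lemma Cexp_RtoC (y : R) : Cexp (RtoC y) = RtoC (exp y).
Proof. unfold Cexp, RtoC. simpl. rewrite cos_0, sin_0. f_equal; ring. Qed.

Lemma canonical_product_RtoC (c : R) (e : Z -> R) (d x : R) :
  (forall k, Rabs (e k) <= d) -> d <= 1 / 10 ->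
  canonical_product c e (RtoC x) = RtoC (real_product c (fun k => IZR k + e k) x).
Proof.
  intros He Hd. set (t := fun k => IZR k + e k).
  assert (Hdr : drift t d).
  { intros m. unfold t. replace (IZR m + e m - IZR m) with (e m) by ring. apply He. }
  assert (Hfac : forall k, t k <> 0 ->
    (let w := RtoC x / RtoC (IZR k + e k) in (1 - w) * Cexp w)%C
    = RtoC ((1 - x / t k) * exp (x * / t k))).
  { intros k Hk. cbv zeta. fold (t k). rewrite <- RtoC_div by exact Hk. rewrite Cexp_RtoC.
    rewrite <- RtoC_minus, <- RtoC_mult. reflexivity. }
  assert (Hprod : forall n, Cprod_sym (fun j : Z =>
     let w := (RtoC x / RtoC (IZR j + e j))%C in ((1 - w) * Cexp w)%C) n =
     RtoC (bprod (lfac t x) n * exp (x * bsum (lrec t) n))).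
  { match goal with |- forall n, Cprod_sym ?f n = _ => set (a := f) in * end.
    assert (Ha : forall k, t k <> 0 -> a k = RtoC ((1 - x / t k) * exp (x * / t k))) by exact Hfac.
    clearbody a. induction n as [|n IH].
    - simpl. rewrite Rmult_0_r, exp_0. f_equal. ring.
    - change (Cprod_sym a (S n)) with
        (Cprod_sym a n * a (Z.of_nat (S n)) * a (- Z.of_nat (S n))%Z)%C.
      rewrite IH.
      destruct (drift_inv t d n Hdr Hd) as [H1 [H2 _]]. pose proof (pos_INR n).
      replace (a (Z.of_nat (S n))) with (a (0 + 1 + Z.of_nat n)%Z) by (f_equal; lia).
      replace (a (- Z.of_nat (S n))%Z) with (a (0 - Z.of_nat (S n))%Z) by (f_equal; lia).
      rewrite (Ha (0 + 1 + Z.of_nat n)%Z), (Ha (0 - Z.of_nat (S n))%Z) by lra.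
      rewrite <- !RtoC_mult. f_equal. cbn [bprod bsum].
      set (L := bprod (lfac t x) n). set (B := bsum (lrec t) n).
      unfold lfac, lrec. rewrite !Rmult_plus_distr_l, !exp_plus. ring. }
  unfold canonical_product, CLim_seq, real_product.
  rewrite (Lim_seq_ext (fun n => Re _) (fun n => bprod (lfac t x) n * exp (x * bsum (lrec t) n)))
    by (intros n; rewrite Hprod; reflexivity).
  rewrite (Lim_seq_ext (fun n => Im _) (fun _ => 0)) by (intros n; rewrite Hprod; reflexivity).
  rewrite Lim_seq_const. change (real 0) with 0.
  set (L := real (Lim_seq _)). change (L, 0) with (RtoC L).
  replace (t 0%Z) with (e 0%Z) by (unfold t; simpl; ring).
  rewrite <- RtoC_minus, <- !RtoC_mult. reflexivity.
Qed.

(** The exponentials of the canonical product collect into exp (b x) with b the sum of [lrec]; the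
    terms are at most 4 d [inv_sq], whence 8 d. The point 1/2 serves for normalization, as the t i
    stay within 1/20 of the integers. *)
Lemma real_product_represents (c : R) (t : Z -> R) (d : R) :
  c <> 0 -> drift t d -> d <= 1 / 20 ->
  exists b, Rabs b <= 8 * d /\ represents (real_product c t) t b.
Proof.
  intros Hc0 Hdr Hd.
  assert (Hd0 : 0 <= d) by (eapply Rle_trans; [apply Rabs_pos|apply (Hdr 0%Z)]).
  assert (Hinv : forall k, _) by (intros k; exact (drift_inv t d k Hdr ltac:(lra))).
  assert (Hp : forall k, t (0 + 1 + Z.of_nat k)%Z <> 0).
  { intros k. destruct (Hinv k) as [H _]. pose proof (pos_INR k). lra. }
  assert (Hq : forall k, t (0 - Z.of_nat (S k))%Z <> 0).
  { intros k. destruct (Hinv k) as [_ [H _]]. pose proof (pos_INR k). lra. }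
  destruct (sums_to_decay (lrec t) (4 * d)) as [b Hb]; [intros k; apply (Hinv k)|].
  exists b. split.
  { replace (8 * d) with (2 * (4 * d)) by ring.
    apply (sums_to_Rabs_le (lrec t)); [|exact Hb].
    intros n. apply bsum_decay; [intros k _; apply (Hinv k)|lra]. }
  assert (Hrho : forall x, exists l : R, is_lim_seq (bprod (lfac t x)) l).
  { intros x. apply (bprod_ex_lim _ (Rabs x + 2 * x ^ 2)).
    - pose proof (Rabs_pos x). pose proof (pow2_ge_0 x). lra.
    - intros k. apply (lfac_decay t d); [exact Hdr|lra]. }
  assert (HF : forall x (l : R), is_lim_seq (bprod (lfac t x)) l ->
    real_product c t x = c * (x - t 0%Z) * (l * exp (x * b))).
  { intros x l Hl. unfold real_product. f_equal.
    rewrite (is_lim_seq_unique _ (l * exp (x * b))); [reflexivity|].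
    apply is_lim_seq_mult'; [exact Hl|].
    apply (is_lim_seq_continuous exp (fun n => x * bsum (lrec t) n) (x * b)).
    - apply derivable_continuous_pt, derivable_pt_exp.
    - apply (is_lim_seq_scal_l _ x b), Hb. }
  pose proof (Hdr 0%Z) as H0. pose proof (Hdr 1%Z) as H1.
  apply (proj1 (Rabs_le_between _ _)) in H0, H1.
  assert (Hnz : forall i, 1 / 2 <> t i).
  { intros i E. pose proof (Hdr i) as H. rewrite <- E in H.
    apply (proj1 (Rabs_le_between _ _)) in H.
    assert (0 < i)%Z by (apply lt_IZR; lra). assert (i < 1)%Z by (apply lt_IZR; lra). lia. }
  destruct (Hrho (1 / 2)) as [l0 Hl0].
  assert (Hlf0 : forall k, lfac t (1 / 2) k <> 0).
  { intros k. unfold lfac. apply Rmult_integral_contrapositive_currified.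
    - pose proof (Hp k) as Hpk. intros E. apply (Hnz (0 + 1 + Z.of_nat k)%Z).
      apply (Rmult_eq_reg_r (/ t (0 + 1 + Z.of_nat k)%Z)); [|apply Rinv_neq_0_compat, Hpk].
      rewrite Rinv_r by exact Hpk. unfold Rdiv in E. lra.
    - pose proof (Hq k) as Hqk. intros E. apply (Hnz (0 - Z.of_nat (S k))%Z).
      apply (Rmult_eq_reg_r (/ t (0 - Z.of_nat (S k))%Z)); [|apply Rinv_neq_0_compat, Hqk].
      rewrite Rinv_r by exact Hqk. unfold Rdiv in E. lra. }
  assert (Hl0nz : l0 <> 0).
  { apply (bprod_lim_neq_0 (lfac t (1 / 2)) (Rabs (1 / 2) + 2 * (1 / 2) ^ 2)); auto.
    - pose proof (Rabs_pos (1 / 2)). lra.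
    - intros k. apply (lfac_decay t d); [exact Hdr|lra]. }
  pose proof (HF _ _ Hl0) as HF0. pose proof (exp_pos (1 / 2 * b)) as He0.
  exists (1 / 2). split; [lra|]. split.
  - rewrite HF0. repeat apply Rmult_integral_contrapositive_currified; auto; lra.
  - intros x. destruct (Hrho x) as [l Hl].
    rewrite (HF x l Hl), HF0.
    apply is_lim_seq_incr_1.
    apply is_lim_seq_ext with (fun n =>
      c * (1 / 2 - t 0%Z) * (l0 * exp (1 / 2 * b)) * exp (b * (x - 1 / 2)) *
      ((x - t 0%Z) * bprod (lfac t x) n / ((1 / 2 - t 0%Z) * bprod (lfac t (1 / 2)) n) *
       (1 + (x - 1 / 2) * / (1 / 2 - t (0 + 1 + Z.of_nat n)%Z)))).
    + intros n. f_equal. unfold pfac. rewrite bprod_div.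
      * rewrite !rawprod_lfac by assumption.
        pose proof (bprod_neq_0 (lfac t (1 / 2)) n ltac:(auto)) as Ha.
        pose proof (bprod_neq_0 (fun k => t (0 + 1 + Z.of_nat k)%Z * t (0 - Z.of_nat (S k))%Z) n
          ltac:(intros; apply Rmult_integral_contrapositive_currified; auto)) as Hb'.
        pose proof (Hnz (0 + 1 + Z.of_nat n)%Z). pose proof (Hnz 0%Z).
        field. repeat split; auto; lra.
      * intros k _. unfold rawfac.
        apply Rmult_integral_contrapositive_currified; apply Rminus_eq_contra, Hnz.
    + replace (c * (x - t 0%Z) * (l * exp (x * b))) with
        (c * (1 / 2 - t 0%Z) * (l0 * exp (1 / 2 * b)) * exp (b * (x - 1 / 2)) *
          ((x - t 0%Z) * l / ((1 / 2 - t 0%Z) * l0) * 1)).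
      * apply is_lim_seq_mult'; [apply is_lim_seq_const|].
        apply is_lim_seq_mult'.
        -- apply is_lim_seq_div'.
           ++ apply is_lim_seq_mult'; [apply is_lim_seq_const|exact Hl].
           ++ apply is_lim_seq_mult'; [apply is_lim_seq_const|exact Hl0].
           ++ apply Rmult_integral_contrapositive_currified; [lra|exact Hl0nz].
        -- apply (linear_ratio_lim _ _ (d + Rabs 1 + Rabs (1 / 2))). intros n.
           apply (drift_far t d (1 / 2) 1 n Hdr).
      * replace (x * b) with (1 / 2 * b + b * (x - 1 / 2)) by field.
        rewrite exp_plus. field. split; [exact Hl0nz|lra].
Qed.

Theorem theorem2p7 :
  exists eps0 K : R, 0 < eps0 /\ 0 < K /\
    forall (eps : R) (e : Z -> R) (c : R) (j : nat) (z : Z -> R),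
      0 < eps < eps0 ->
      (forall k : Z, Rabs (e k) < eps) ->
      c <> 0 ->
      (1 <= j)%nat ->
      lists_zeros (C_derive_n (canonical_product c e) j) z ->
      forall n : Z, Rabs (z (n + 1)%Z - z n - 1) <= K * (eps / INR j).
Proof.
  (* For eps < 1/30 the deviation bound 2 eps is at most 1/10, eps itself at most 1/20, and |b| <= 8
     eps at most 1/3. The factor 16384 is 2 times 8192, since e = 2 eps. *)
  exists (1 / 30), 16384. split; [lra|]. split; [lra|].
  intros eps e c j z Heps He Hc Hj Hz n.
  set (t := fun k => IZR k + e k).
  assert (Hdr : drift t eps).
  { intros m. unfold t. replace (IZR m + e m - IZR m) with (e m) by ring. left. apply He. }
  assert (Hosc : osc t (2 * eps)).
  { intros m r. unfold t. rewrite plus_IZR.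
    replace (IZR m + IZR r + e (m + r)%Z - (IZR m + e m) - IZR r) with (e (m + r)%Z - e m) by ring.
    pose proof (He m) as H1. pose proof (He (m + r)%Z) as H2.
    apply Rabs_def2 in H1, H2. apply Rabs_le. split; lra. }
  destruct (real_product_represents c t eps Hc Hdr ltac:(lra)) as [b [Hb HF]].
  pose proof (fun x => canonical_product_RtoC c e eps x
    (fun k => Rlt_le _ _ (He k)) ltac:(lra)) as Hf.
  destruct (derivative_tower (canonical_product c e) (real_product c t) t b (2 * eps) j
    Hosc ltac:(lra) ltac:(lra) Hf HF) as [T [HT0 [HT [G [HG HGr]]]]].
  destruct (gap_decay T b (2 * eps) j) as [Hoj Hgap]; [lra|lra|rewrite HT0; exact Hosc|exact HT|].
  (* One derivative beyond the j-th shows that the zeros of the j-th are simple. *)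
  destruct (derivative_step (C_derive_n (canonical_product c e) j) G (T j) b (2 * eps)
    Hoj ltac:(lra) ltac:(lra) HG HGr) as [s [G' [Hs [HG' HGr']]]].
  destruct (lists_zeros_gap _ G G' (T j) s _ b z
    (osc_increasing _ _ Hoj ltac:(lra)) (osc_drift _ _ Hoj) Hs HG HGr HG' HGr' Hz n) as [k [Hk Hk']].
  rewrite Hk, Hk'. eapply Rle_trans; [apply Hgap|].
  assert (HJ : 0 < INR j) by (apply lt_0_INR; lia).
  unfold Rdiv. replace (8192 * (2 * eps) * / (INR j + 1)) with (16384 * (eps * / (INR j + 1))) by (field; lra).
  apply Rmult_le_compat_l; [lra|]. apply Rmult_le_compat_l; [lra|].
  apply Rinv_le_contravar; lra.
Qed.
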